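(* Let $p>2$ be a prime and let $q=p^{r}$ with $r\geq 2$. Let $C\subseteq\mathbb{P}^2$ be a smooth non-reflexive plane curve of degree $p+1$ or $2p+1$ defined over $\mathbb{F}_q$. Then there is a line $L\subseteq\mathbb{P}^2$ defined over $\mathbb{F}_q$ such that $L$ intersects $C$ transversely.
   Context: A plane curve of degree $d$ defined over $\mathbb{F}_q$ is the zero locus in $\mathbb{P}^2$ of a homogeneous polynomial of degree $d$ in $\mathbb{F}_q[x,y,z]$; smooth means nonsingular at every geometric point (over $\overline{\mathbb{F}_q}$). An $\mathbb{F}_q$-line is a line in $\mathbb{P}^2$ defined over $\mathbb{F}_q$. A line $L$ intersects $C$ transversely if $C\cap L$ consists of $d=\deg(C)$ distinct geometric points (points over $\overline{\mathbb{F}_q}$). Reflexivity: the Gauss map $\varphi: C\to(\mathbb{P}^2)^{*}$ sends each smooth point $P$ of $C$ to its tangent line $T_P(C)$, regarded as a point of the dual plane $(\mathbb{P}^2)^{*}$. The dual curve $C^{*}$ is the closure of $\varphi(C)$ in $(\mathbb{P}^2)^{*}$. The Gauss map of the dual curve is a (rational) map $\varphi': C^{*}\to C^{**}$, where $C^{**}\subseteq(\mathbb{P}^2)^{**}$ and $(\mathbb{P}^2)^{**}$ is identified with $\mathbb{P}^2$. The curve $C$ is called reflexive if $C=C^{**}$ and $\varphi'\circ\varphi: C\to C^{**}$ is the identity map, and non-reflexive otherwise. *)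

(* Defs.v *)
From HB Require Import structures.
From mathcomp Require Export all_boot all_order all_algebra.
From mathcomp Require Export mpoly.

Set Implicit Arguments.
Unset Strict Implicit.
Unset Printing Implicit Defensive.

Import GRing.Theory.
Local Open Scope ring_scope.

(* A point of P^2(K) is a nonzero row vector, and two of them are the same
   point when they span the same row space, (P == Q)%MS.  A point of the dual
   plane is the coefficient vector of a line; since the bidual plane is
   identified with P^2, all three planes use 'rV[K]_3. *)
Section PlaneCurves.

Variable K : fieldType.
Implicit Types (f g : {mpoly K[3]}) (P Q L M v : 'rV[K]_3).
Implicit Types (X : 'rV[K]_3 -> Prop).

Definition peval f P : K := f.@[P 0].

Definition gradient f P : 'rV[K]_3 := \row_i peval f^`M(i) P.

Definition incident L v : Prop := L *m v^T = 0.

Definition zero_locus f P : Prop := P != 0 /\ peval f P = 0.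

Definition smooth f : Prop := forall P, zero_locus f P -> gradient f P != 0.

Definition vanishing X g : Prop :=
  (exists e, g \is e.-homog) /\ forall P, X P -> peval g P = 0.

Definition zariski_closure X Q : Prop :=
  Q != 0 /\ forall g, vanishing X g -> peval g Q = 0.

(* The affine cone over the projective tangent space of X at P, where X
   carries its reduced structure. *)
Definition tangent_space X P v : Prop :=
  forall g, vanishing X g -> incident (gradient g P) v.

(* For a curve X, "P is a smooth point of X and T_P(X) = L": at a singular
   point the tangent space is the whole plane.  This is the graph of the Gauss
   map of X, whose domain is the smooth locus. *)
Definition gauss_map X P L : Prop :=
  [/\ X P, L != 0 & forall v, tangent_space X P v <-> incident L v].

Definition dual_curve X : 'rV[K]_3 -> Prop :=
  zariski_closure (fun L => exists P, gauss_map X P L).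

(* The composite of the two Gauss maps is a rational map: it is compared with
   the identity at every point where both of them are defined. *)
Definition reflexive_curve X : Prop :=
  (forall P, X P <-> dual_curve (dual_curve X) P) /\
  (forall P L M, gauss_map X P L -> gauss_map (dual_curve X) L M ->
     (M == P)%MS).

Definition has_exactly_points (d : nat) X : Prop :=
  exists s : 'I_d -> 'rV[K]_3,
    [/\ forall i, X (s i),
        forall i j, (s i == s j)%MS -> i = j
      & forall P, X P -> exists i, (P == s i)%MS].

(* Here f is homogeneous of degree d and K is algebraically closed. *)
Definition transverse (d : nat) f L : Prop :=
  has_exactly_points d (fun P => zero_locus f P /\ incident L P).

End PlaneCurves.

(* Main.v *)
Require Import Defs.
From mathcomp Require Import finfield.
From mathcomp Require Import zify ring.

Set Implicit Arguments.
Unset Strict Implicit.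
Unset Printing Implicit Defensive.

Import GRing.Theory.
Local Open Scope ring_scope.

(** Let q = #|F|, let C be the curve f = 0, let f_i be the partial derivatives of
f and Phi the q-th power Frobenius map on points. Suppose that none of the
q^2 + q + 1 lines over F is transverse.

Each of these lines L then meets C at a point P with T_P C = L
([transverse_or_tangent]), and different lines have different tangency points,
since the line is recovered from the gradient of f. As L is defined over F it
contains Phi(P), so P lies on the curve D: sum x_i^q f_i = 0, of degree
q + d - 1, which says that Phi(P) is on T_P C. If P is not rational, then Phi(P)
is a second tangency point of the same L; and at most d(q + 1) tangency points
are rational, because F-rational points of C are distributed over q + 1 lines
([rational_zero_count]). So C and D have at least 2(q^2 + q + 1) - d(q + 1)
common points, more than d(q + d - 1) ([tangency_bound]), and by Bezout's bound
([bezout_covers]) D contains C.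

Hence Phi(P) is on T_P C for every P on C. In differentiating this relation along
C the q-th powers behave like constants, so the Gauss map has zero differential:
every nonrational point is a flex ([frobenius_flex]). Then the Hessian of f is zero
([hessian_eq0]). The reason is that d is 1 in K and p > 2: on C the Hessian
quadratic form vanishes on the plane orthogonal to the gradient L, hence is a
product 2 L m, and the coefficients of the linear form m are regular functions on
C of degree (d - 2) - (d - 1) = -1, hence zero.

So each f_i is the p-th power of a form g_i of degree k = (d - 1) / p, which is 1
or 2. The q + 1 lines over F through a coordinate point e_i have their tangency
points on g_i = 0, and Bezout's bound is contradicted when d k < q + 1. Otherwise k = 2 and
q = p^2; then the equation of D is the p-th power of
E = sum x_i^p g_i; now E vanishes on C and has degree p + 2 < d, so E = 0, and two
derivations, for which x_i^p is a constant, give g_i = 0 ([quadratic_syzygy]).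

All statements of Bezout type come from the projection of C from a point O off C.
The product of the values of a form g over the points of C on a line through O is
a binary form of degree deg f * deg g ([fiber_norm_poly]). If it is zero, then f
divides g, because a smooth f is irreducible: two factors would have a common zero,
and it would be a singular point ([factors_meet], [chart_dvd]). *)

(** * Univariate polynomials over an algebraically closed field *)

Lemma prod_seq_constM (R : comNzRingType) (T : Type) (s : seq T) (c : R) F :
  \prod_(z <- s) (c * F z) = c ^+ size s * \prod_(z <- s) F z.
Proof.
elim: s => [|z s IH]; first by rewrite !big_nil expr0 mulr1.
by rewrite !big_cons IH /= exprS mulrACA.
Qed.

Lemma perm_prod_XsubC (R : idomainType) (s t : seq R) :
  \prod_(z <- s) ('X - z%:P) = \prod_(z <- t) ('X - z%:P) -> perm_eq s t.
Proof.
elim: s t => [|x s IH] t e.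
  have := size_prod_XsubC t id; rewrite /= -e big_nil size_poly1.
  by case: t {e}.
have xt : x \in t by rewrite -root_prod_XsubC -e root_prod_XsubC mem_head.
rewrite perm_sym (perm_trans (perm_to_rem xt)) // perm_cons perm_sym IH //.
move: e; rewrite big_cons (perm_big _ (perm_to_rem xt)) big_cons.
by apply: mulfI; rewrite polyXsubC_eq0.
Qed.

Section Univariate.

Variable K : closedFieldType.

Definition roots_of (p : {poly K}) : seq K := sval (closed_field_poly_normal p).

Lemma roots_ofE p : p = lead_coef p *: \prod_(z <- roots_of p) ('X - z%:P).
Proof. exact: svalP (closed_field_poly_normal p). Qed.

Lemma roots_of_monic p : p \is monic -> p = \prod_(z <- roots_of p) ('X - z%:P).
Proof. by move=> /monicP mp; rewrite {1}[p]roots_ofE mp scale1r. Qed.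

Lemma mem_roots_of p z : p \is monic -> (z \in roots_of p) = root p z.
Proof. by move=> mp; rewrite [in RHS](roots_of_monic mp) root_prod_XsubC. Qed.

Lemma size_roots_of p : p \is monic -> size (roots_of p) = (size p).-1.
Proof. by move=> mp; rewrite [in RHS](roots_of_monic mp) size_prod_XsubC. Qed.

(** An algebraically closed field is infinite, so finitely many exceptions are
harmless; the exceptions will be the point at infinity of a pencil of lines, or
the lines through some rational points. *)
Lemma poly_ext (s : seq K) (p q : {poly K}) :
  (forall a, a \notin s -> p.[a] = q.[a]) -> p = q.
Proof.
move=> epq; apply/eqP; rewrite -subr_eq0; apply/negPn/negP=> npq.
have : (p - q) * \prod_(a <- s) ('X - a%:P) != 0.
  by rewrite mulf_neq0 // monic_neq0 // monic_prod_XsubC.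
case/closed_nonrootP=> x; rewrite rootM root_prod_XsubC negb_or => /andP[nr /epq e].
by move: nr; rewrite /root hornerD hornerN e subrr eqxx.
Qed.

(** P is the polynomial Q read in the other affine coordinate of the projective
line, in degree m. Comparing the two gives a degree bound without looking at
coefficients. *)
Lemma reverse_poly_coef (P Q : {poly K}) m :
  (forall a, a != 0 -> P.[a] = a ^+ m * Q.[a^-1]) ->
  forall k, P`_k = if (k <= m)%N then Q`_(m - k) else 0.
Proof.
move=> ePQ k; set n := size Q.
have {}ePQ : P * 'X^n = \sum_(i < n) Q`_i *: 'X^(m + (n - i)).
  apply: (@poly_ext [:: 0]) => a; rewrite inE => a0.
  rewrite hornerM hornerXn ePQ // mulrAC -exprD horner_coef -/n mulr_sumr.
  rewrite horner_sum; apply: eq_bigr => i _; rewrite hornerZ hornerXn mulrCA.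
  congr (_ * _); rewrite exprVn -expfB_cond ?(negPf a0) ?add0n; last first.
    by rewrite (leq_trans (ltnW (ltn_ord i))) ?leq_addl.
  by rewrite addnBA // ltnW.
have := congr1 (fun p : {poly K} => p`_(n + k)) ePQ.
rewrite coefMXn ltnNge leq_addr /= addKn => ->; rewrite coef_sum.
under eq_bigr => i _ do rewrite coefZ coefXn.
case: leqP => km; last first.
  rewrite big1 // => i _; case: eqP => [e|_]; rewrite ?mulr0 //.
  move: (ltn_ord i) km e; lia.
case: (ltnP (m - k) n) => mn; last first.
  rewrite nth_default // big1 // => i _; case: eqP => [e|_]; rewrite ?mulr0 //.
  move: (ltn_ord i) km mn e; lia.
rewrite (bigD1 (Ordinal mn)) //= big1 ?addr0 => [|i ni].
  by rewrite (_ : _ == _) ?mulr1 //; apply/eqP; lia.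
case: eqP => [e|_]; rewrite ?mulr0 //; case/eqP: ni; apply: val_inj => /=.
move: (ltn_ord i) km mn e; lia.
Qed.

(** The coefficient of degree m is the value at infinity. *)
Lemma reverse_poly_size (P Q : {poly K}) m :
  (forall a, a != 0 -> P.[a] = a ^+ m * Q.[a^-1]) ->
  (size P <= m.+1)%N /\ P`_m = Q.[0].
Proof.
move=> /reverse_poly_coef e; split; last by rewrite e leqnn subnn horner_coef0.
by apply/leq_sizeP => j mj; rewrite e leqNgt mj.
Qed.

(** The determinant is multiplicative in g, and for g = 'X - s it is, up to
sign, the characteristic polynomial at s. *)
Lemma det_horner_mx n (M : 'M[K]_n.+1) (g : {poly K}) :
  \det (horner_mx M g) = \prod_(z <- roots_of (char_poly M)) g.[z].
Proof.
have [r [-> szr er]] : exists r, [/\ roots_of (char_poly M) = r, size r = n.+1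
    & forall s, (char_poly M).[s] = \prod_(z <- r) (s - z)].
  exists (roots_of (char_poly M)); split=> [//||s].
    by rewrite size_roots_of ?char_poly_monic // size_char_poly.
  rewrite {1}(roots_of_monic (char_poly_monic M)) horner_prod.
  by apply: eq_bigr => z _; rewrite hornerXsubC.
have detX s : \det (horner_mx M ('X - s%:P)) = \prod_(z <- r) (z - s).
  have -> : horner_mx M ('X - s%:P) = - map_mx (horner_eval s) (char_poly_mx M).
    rewrite rmorphB /= horner_mx_X horner_mx_C; apply/matrixP=> i j.
    rewrite !mxE /horner_eval /= hornerD hornerN hornerMn hornerX hornerC.
    by rewrite opprB.
  rewrite -scaleN1r detZ.
  transitivity ((- 1) ^+ n.+1 * (char_poly M).[s]); first by rewrite det_map_mx.
  rewrite er -szr -prod_seq_constM; apply: eq_bigr => z _.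
  by rewrite mulN1r opprB.
rewrite [in LHS](roots_ofE g) linearZ /= detZ rmorph_prod.
have -> : \det (\prod_(i <- roots_of g) horner_mx M ('X - i%:P)) =
   \prod_(s <- roots_of g) \prod_(z <- r) (z - s).
  elim: (roots_of g) => [|s t IH]; rewrite ?big_nil ?det1 // !big_cons.
  by rewrite det_mulmx IH detX.
rewrite -szr exchange_big -prod_seq_constM /=; apply: eq_bigr => z _.
rewrite [in RHS](roots_ofE g) hornerZ horner_prod; congr (_ * _).
by apply: eq_bigr => s _; rewrite hornerXsubC.
Qed.

End Univariate.

(** * Bivariate polynomials and norms along fibres *)

Section Bivariate.

Variable K : closedFieldType.
Implicit Types (A B F G : {poly {poly K}}) (a z : K).

(** The outer variable of A is the coordinate z on the lines of a pencil, and the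
inner variable is the parameter a of the pencil. *)
Definition fiber A a : {poly K} := map_poly (horner_eval a) A.

Definition eval2 A a z : K := (fiber A a).[z].

Lemma coef_fiber A a j : (fiber A a)`_j = (A`_j).[a].
Proof. by rewrite coef_map. Qed.

Lemma fiberM A B a : fiber (A * B) a = fiber A a * fiber B a.
Proof. by rewrite /fiber rmorphM. Qed.

Lemma eval2M A B a z : eval2 (A * B) a z = eval2 A a z * eval2 B a z.
Proof. by rewrite /eval2 fiberM hornerM. Qed.

Lemma eval2D A B a z : eval2 (A + B) a z = eval2 A a z + eval2 B a z.
Proof. by rewrite /eval2 /fiber rmorphD hornerD. Qed.

Lemma eval2C (c : {poly K}) a z : eval2 c%:P a z = c.[a].
Proof. by rewrite /eval2 /fiber map_polyC hornerC. Qed.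

Lemma horner_section A a z : A.[z%:P].[a] = eval2 A a z.
Proof.
by rewrite /eval2 /fiber -[LHS]/(horner_eval a _) -horner_map /= [X in _.[X]]hornerC.
Qed.

Lemma size_fiber A a : A \is monic -> size (fiber A a) = size A.
Proof.
by move=> /monicP mA; rewrite size_map_poly_id0 // mA /horner_eval hornerC oner_neq0.
Qed.

Lemma fiber_monic A a : A \is monic -> fiber A a \is monic.
Proof. exact: monic_map. Qed.

Lemma eval2_ext (s : seq K) A B :
  (forall a z, a \notin s -> eval2 A a z = eval2 B a z) -> A = B.
Proof.
move=> eAB; apply/polyP => j; apply: (@poly_ext _ s) => a /eAB e.
rewrite -!coef_fiber.
by have -> : fiber A a = fiber B a by apply: (@poly_ext _ [::]) => z _; exact: e.
Qed.

Lemma fiber_eq0 A a : fiber A a = 0 -> exists B, A = ('X - a%:P) *: B.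
Proof.
move=> A0; exists (map_poly (fun p => p %/ ('X - a%:P)) A); apply/polyP => j.
rewrite coefZ coef_map_id0 ?div0p // mulrC divpK // -root_factor_theorem.
by rewrite /root -coef_fiber A0 coef0.
Qed.

Lemma scale_poly_inj (c : {poly K}) A B : c != 0 -> c *: A = c *: B -> A = B.
Proof. by move=> c0; rewrite -!mul_polyC => /mulfI-> //; rewrite polyC_eq0. Qed.

(** Gauss's lemma: a root a of c makes the fibre of B or of A at a vanish, so that
'X - a can be cancelled. *)
Lemma gauss_factor F A B (c : {poly K}) : F != 0 -> c != 0 -> c *: F = B * A ->
  exists A1 B1 e, [/\ e != 0, A = e *: A1 & F = B1 * A1].
Proof.
move=> F0; have [n] := ubnP (size c); elim: n => // n IH in c A B * => sz c0 e.
have [/size1_polyC|nc] := leqP (size c) 1.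
  set c1 := c`_0 => ec; exists A, ((c1^-1)%:P *: B), 1.
  rewrite oner_neq0 scale1r -scalerAl -e ec scalerA -polyCM mulVf ?scale1r //.
  by apply: contraNneq c0 => c10; rewrite ec c10.
have /closed_rootP[a] : size c != 1 by rewrite gtn_eqF.
case/factor_theorem=> c' ec; move: c0 nc sz e; rewrite {}ec.
rewrite mulf_eq0 negb_or polyXsubC_eq0 andbT => c'0 _ sz e.
have {}sz : (size c' < n)%N.
  by move: sz; rewrite size_Mmonic ?monicXsubC // size_XsubC addn2.
have := congr1 (fiber^~ a) e; rewrite /= fiberM -mul_polyC fiberM.
have -> : fiber (c' * ('X - a%:P))%:P a = 0.
  by apply/polyP=> i; rewrite coef_fiber coefC coef0; case: eqP;
     rewrite ?horner0 // hornerM hornerXsubC subrr mulr0.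
have Xa0 : 'X - a%:P != 0 by rewrite polyXsubC_eq0.
move/esym/eqP; rewrite mul0r mulf_eq0 => /orP[/eqP|/eqP] /fiber_eq0[C eC].
- apply: (IH c' A C) => //; apply: (scale_poly_inj Xa0).
  by rewrite scalerA mulrC e eC scalerAl.
- have [//|||A1 [B1 [d [d0 eA eF]]]] := IH c' C B => //.
    by apply: (scale_poly_inj Xa0); rewrite scalerA mulrC e eC scalerAr.
  exists A1, B1, (('X - a%:P) * d); split=> //; first by rewrite mulf_neq0.
  by rewrite eC eA scalerA.
Qed.

(** The product over the roots of a fibre of F is a determinant: evaluate G at a
companion matrix of F. *)
Lemma norm_poly F G : F \is monic -> (1 < size F)%N ->
  exists P : {poly K}, forall a, P.[a] = \prod_(z <- roots_of (fiber F a)) eval2 G a z.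
Proof.
move=> mF; case sF: (size F) => [|[|n]] // _.
have [M eM] : exists M : 'M[{poly K}]_n.+1, char_poly M = F.
  move: (companionmx F) (companionmxK mF); rewrite sF => M eM; by exists M.
exists (\det (horner_mx M G)) => a.
rewrite -[LHS]/(horner_eval a _) -det_map_mx map_horner_mx det_horner_mx.
by rewrite -map_char_poly eM.
Qed.

(** Total degree at most d. *)
Definition weighted d A := forall j, A`_j != 0 -> (size (A`_j)%R + j <= d.+1)%N.

(** The substitution (x, z) := (x, x z) turns the total degree into the degree in x,
which is additive under products. *)
Definition twist A := A \Po ('X%:P * 'X).

Lemma coef_twist A j : (twist A)`_j = A`_j * 'X^j.
Proof.
rewrite /twist comp_polyE coef_sum.
under eq_bigr => i _ do rewrite exprMn -rmorphXn /= mul_polyC scalerA coefZ coefXn.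
have [jA|Aj] := ltnP j (size A).
  rewrite (bigD1 (Ordinal jA)) //= eqxx mulr1 big1 ?addr0 // => i.
  by rewrite -val_eqE /= eq_sym => /negPf ->; rewrite mulr0.
rewrite [A`_j]nth_default // mul0r big1 // => i _.
by rewrite gtn_eqF ?mulr0 // (leq_trans (ltn_ord i)).
Qed.

Lemma twistM A B : twist (A * B) = twist A * twist B.
Proof. exact: rmorphM. Qed.

Lemma sizeYM A B : A != 0 -> B != 0 -> sizeY (A * B) = (sizeY A + sizeY B).-1.
Proof.
by move=> A0 B0; rewrite !sizeYE rmorphM size_mul ?swapXY_eq0.
Qed.

Lemma weighted_twist d A : (sizeY (twist A) <= d.+1)%N <-> weighted d A.
Proof.
split=> [sA j Aj|wA].
  apply: leq_trans sA; rewrite addnC -size_mulXn // -coef_twist; exact: max_size_coefXY.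
apply/bigmax_leqP => j _; rewrite coef_twist.
have [->|Aj] := eqVneq A`_j 0; first by rewrite mul0r size_poly0.
by rewrite size_mulXn // addnC; apply: wA.
Qed.

Lemma sizeY_twist_ge A : A != 0 -> (size A <= sizeY (twist A))%N.
Proof.
move=> A0; apply: leq_trans (max_size_coefXY _ (size A).-1).
rewrite coef_twist -lead_coefE size_mulXn ?lead_coef_eq0 //.
have sA : (0 < size A)%N by rewrite size_poly_gt0.
by rewrite -{1}(prednK sA) -addn1 leq_add2l size_poly_gt0 lead_coef_eq0.
Qed.

Lemma twist_eq0 A : (twist A == 0) = (A == 0).
Proof.
apply/eqP/eqP=> [e|->]; last by rewrite /twist rmorph0.
apply/polyP=> j; have := congr1 (fun p : {poly {poly K}} => p`_j) e.
rewrite coef_twist !coef0 => /eqP; rewrite mulf_eq0 expf_eq0 polyX_eq0 andbF orbF.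
by move/eqP.
Qed.

(** Both factors have total degree at least their degree in z, and the total degrees
add up to at most k + l. *)
Lemma weighted_factor k l A B : size A = k.+1 -> size B = l.+1 ->
  weighted (k + l) (A * B) -> weighted k A.
Proof.
move=> sA sB /weighted_twist; have A0 : A != 0 by rewrite -size_poly_gt0 sA.
have B0 : B != 0 by rewrite -size_poly_gt0 sB.
rewrite twistM sizeYM ?twist_eq0 // => le; apply/weighted_twist.
move: (sizeY_twist_ge A0) (sizeY_twist_ge B0) le; rewrite sA sB; lia.
Qed.

(** A' is the same form of degree k as A, dehomogenized at the other coordinate of
the pencil. *)
Lemma weighted_reverse k A : A \is monic -> size A = k.+1 -> weighted k A ->
  exists A', [/\ A' \is monic, size A' = k.+1 &
    forall a z, a != 0 -> eval2 A' a z = a ^+ k * eval2 A a^-1 (z / a)].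
Proof.
move=> mA sA wA; set A' := \poly_(j < k.+1) \poly_(i < (k - j).+1) (A`_j)`_(k - j - i).
have A'k : A'`_k = 1.
  have Ak : A`_k = 1 by move/monicP: mA; rewrite lead_coefE sA.
  by rewrite coef_poly leqnn subnn Ak; apply/polyP=> -[|i]; rewrite coef_poly coef1 ?coef1.
have sA' : size A' = k.+1.
  apply/eqP; rewrite eqn_leq size_poly ltnNge; apply/negP=> sk.
  by move: A'k; rewrite nth_default // => /esym/eqP; rewrite oner_eq0.
exists A'; split=> //; first by rewrite monicE lead_coefE sA' A'k.
move=> a z a0; rewrite {A'k sA'}/A'.
rewrite /eval2 !(@horner_coef_wide _ k.+1) ?(leq_trans (size_poly _ _)) ?size_poly ?sA //.
rewrite mulr_sumr; apply: eq_bigr => j _; rewrite !coef_fiber coef_poly ltn_ord.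
have jk : (j <= k)%N by rewrite -ltnS.
rewrite (@horner_coef_wide _ (k - j).+1) ?size_poly //.
rewrite (@horner_coef_wide _ (k - j).+1 A`_j); last first.
  have [->|/wA] := eqVneq A`_j 0; first by rewrite size_poly0.
  by move: jk; lia.
rewrite mulr_suml mulr_suml mulr_sumr (reindex_inj rev_ord_inj) /=.
apply: eq_bigr => i _; rewrite coef_poly subSS.
have ik : (i <= k - j)%N by rewrite -ltnS.
rewrite ltnS leq_subr subKn // expr_div_n exprVn.
have -> : a ^+ k = a ^+ (k - j - i) * a ^+ i * a ^+ j.
  by rewrite -!exprD; congr (_ ^+ _); lia.
by field; rewrite ?expf_neq0.
Qed.

(** A point has coordinate z in one chart and a z in the other. *)
Lemma roots_of_fiber_reverse k A A' a : A \is monic -> A' \is monic ->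
  size A = k.+1 -> a != 0 ->
  (forall z, eval2 A' a z = a ^+ k * eval2 A a^-1 (z / a)) ->
  perm_eq (roots_of (fiber A' a)) [seq a * z | z <- roots_of (fiber A a^-1)].
Proof.
move=> mA mA' sA a0 e; apply: perm_prod_XsubC.
rewrite -roots_of_monic ?fiber_monic // big_map.
apply: (@poly_ext _ [::]) => z _; rewrite -/(eval2 A' a z) e.
have sr : size (roots_of (fiber A a^-1)) = k.
  by rewrite size_roots_of ?fiber_monic // size_fiber // sA.
rewrite /eval2 {1}(roots_of_monic (fiber_monic a^-1 mA)) !horner_prod -{1}sr.
rewrite -prod_seq_constM; apply: eq_bigr => x _.
by rewrite !hornerXsubC mulrBr mulrCA divff ?mulr1.
Qed.

Lemma norm_reverse k e A A' G G' a : A \is monic -> A' \is monic ->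
  size A = k.+1 -> a != 0 ->
  (forall z, eval2 A' a z = a ^+ k * eval2 A a^-1 (z / a)) ->
  (forall z, eval2 G' a z = a ^+ e * eval2 G a^-1 (z / a)) ->
  \prod_(z <- roots_of (fiber A' a)) eval2 G' a z =
  a ^+ (k * e) * \prod_(z <- roots_of (fiber A a^-1)) eval2 G a^-1 z.
Proof.
move=> mA mA' sA a0 eA eG.
rewrite (perm_big _ (roots_of_fiber_reverse mA mA' sA a0 eA)) big_map.
have sr : size (roots_of (fiber A a^-1)) = k.
  by rewrite size_roots_of ?fiber_monic // size_fiber // sA.
rewrite mulnC exprM -[X in _ ^+ X]sr -prod_seq_constM; apply: eq_bigr => z _.
by rewrite eG mulrAC divff // mul1r.
Qed.

Lemma norm_eq0P A G a : A \is monic ->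
  (\prod_(z <- roots_of (fiber A a)) eval2 G a z == 0) <->
  (exists z, eval2 A a z = 0 /\ eval2 G a z = 0).
Proof.
move=> mA; split.
  rewrite prodf_seq_eq0 => /hasP[z].
  by rewrite mem_roots_of ?fiber_monic // => /rootP Az /eqP Gz; exists z.
case=> z [/rootP]; rewrite -mem_roots_of ?fiber_monic // => Az Gz.
by rewrite prodf_seq_eq0; apply/hasP; exists z => //; rewrite Gz eqxx.
Qed.

Lemma weighted_of_reverse d F F' : (size F <= d.+1)%N ->
  (forall a z, a != 0 -> eval2 F' a z = a ^+ d * eval2 F a^-1 (z / a)) ->
  weighted d F.
Proof.
move=> sF eF j Fj0.
have jd : (j <= d)%N.
  rewrite -ltnS; apply: leq_trans sF; rewrite ltnNge; apply: contraNN Fj0 => h.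
  by rewrite nth_default.
suff [s _] : (size (F`_j)%R <= (d - j).+1)%N /\ (F`_j)`_(d - j) = (F'`_j).[0].
  by move: s jd; lia.
apply: reverse_poly_size => a a0.
have ia0 : a^-1 != 0 by rewrite invr_eq0.
have h : fiber F' a^-1 = a^-1 ^+ d *: \poly_(i < size F) ((F`_i).[a] * a ^+ i).
  apply: (@poly_ext _ [::]) => z _; rewrite -/(eval2 _ _ _) eF // invrK hornerZ.
  rewrite /eval2 horner_poly (@horner_coef_wide _ (size F)) ?size_poly //.
  by congr (_ * _); apply: eq_bigr => i _; rewrite coef_fiber exprMn; ring.
rewrite -(coef_fiber F') h coefZ coef_poly.
case: ltnP => [_|sj]; last by rewrite nth_default ?eqxx // in Fj0.
have -> : a ^+ (d - j) = a ^+ d / a ^+ j.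
  by rewrite -expfB_cond ?(negPf a0) ?add0n.
by rewrite exprVn; field; rewrite !expf_neq0.
Qed.

(** When F is an affine equation of a smooth curve, this says that a common zero of
two factors would be singular. *)
Definition factors_disjoint F := forall A B a z,
  F = B * A -> eval2 A a z = 0 -> eval2 B a z = 0 -> False.

(** Bezout for two factors A and B of a curve, smooth in both charts F and F' of the
pencil. The norm of B along A has no root, so it is a constant; read in the other
chart it is this constant times a positive power of the parameter, which vanishes
at 0. So A and B meet, possibly at infinity. *)
Lemma factors_meet k l A B F' : A \is monic -> B \is monic ->
  size A = k.+2 -> size B = l.+2 -> weighted (k.+1 + l.+1) (A * B) ->
  (forall a z, a != 0 ->
     eval2 F' a z = a ^+ (k.+1 + l.+1) * eval2 (A * B) a^-1 (z / a)) ->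
  factors_disjoint (A * B) -> factors_disjoint F' -> False.
Proof.
move=> mA mB sA sB wAB eF' disj disj'.
have wA := weighted_factor sA sB wAB.
have wB : weighted l.+1 B by apply: (weighted_factor sB sA); rewrite mulrC addnC.
have [A' [mA' sA' eA']] := weighted_reverse mA sA wA.
have [B' [mB' sB' eB']] := weighted_reverse mB sB wB.
have F'E : F' = B' * A'.
  apply: (@eval2_ext [:: 0]) => a z; rewrite inE => a0.
  by rewrite eF' // !eval2M eA' // eB' // exprD; ring.
have [|P eP] := norm_poly B mA; first by rewrite sA.
have [|P' eP'] := norm_poly B' mA'; first by rewrite sA'.
have Pconst : ~ exists a, root P a.
  case=> a /rootP/eqP; rewrite eP => /(norm_eq0P _ _ mA)[z [Az Bz]].
  by apply: (disj A B a z) => //; rewrite mulrC.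
have {Pconst} Pc : P = (P`_0)%:P.
  apply: size1_polyC; rewrite leqNgt; apply/negP => sP; apply: Pconst.
  by apply/closed_rootP; rewrite gtn_eqF.
have P'E : P' = P`_0 *: 'X^(k.+1 * l.+1).
  apply: (@poly_ext _ [:: 0]) => a; rewrite inE => a0.
  rewrite eP' (norm_reverse mA mA' sA a0 (e := l.+1) (G := B)); last first.
  - by move=> z; rewrite eB'.
  - by move=> z; rewrite eA'.
  by rewrite -eP hornerZ hornerXn Pc hornerC coefC eqxx mulrC.
have : P'.[0] = 0 by rewrite P'E hornerZ hornerXn expr0n mulr0.
move/eqP; rewrite eP' => /(norm_eq0P _ _ mA')[z [Az Bz]].
exact: (disj' A' B' 0 z).
Qed.

(** The resultant of F and G has infinitely many zeros, so F and G have a common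
factor of positive degree in z; by Gauss's lemma it comes from a factor of F, and by
[factors_meet] this factor is F itself. *)
Lemma dvd_of_common_zero_in_fibers d F F' G : F \is monic -> size F = d.+2 ->
  (forall a z, a != 0 -> eval2 F' a z = a ^+ d.+1 * eval2 F a^-1 (z / a)) ->
  factors_disjoint F -> factors_disjoint F' ->
  (forall a, exists z, eval2 F a z = 0 /\ eval2 G a z = 0) ->
  exists Q, G = Q * F.
Proof.
move=> mF sF eF' disj disj' com.
have F0 : F != 0 by rewrite -size_poly_gt0 sF.
have [/size1_polyC Gc|sG] := leqP (size G) 1.
  exists 0; rewrite mul0r Gc; congr _%:P; apply: (@poly_ext _ [::]) => a _.
  by have [z [_ Gz]] := com a; rewrite horner0 -(eval2C _ a z) -Gc.
have res0 : resultant F G = 0.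
  have [|UV _ e] := resultant_in_ideal _ sG (p := F); first by rewrite sF.
  apply: (@poly_ext _ [::]) => a _; have [z [Fz Gz]] := com a.
  by rewrite -(eval2C (resultant F G) a z) e eval2D !eval2M Fz Gz !mulr0 addr0 horner0.
have sD : (1 < size (gcdp F G))%N by rewrite -resultant_eq0 res0 eqxx.
have /Pdiv.Idomain.dvdpP[[c B] /= c0 eF] := dvdp_gcdl F G.
have /Pdiv.Idomain.dvdpP[[c' C] /= c'0 eG] := dvdp_gcdr F G.
have [A [B1 [e [e0 eA eFAB]]]] := gauss_factor F0 c0 eF.
have AB0 : B1 * A != 0 by rewrite -eFAB.
have [B10 A0] : B1 != 0 /\ A != 0 by apply/andP; rewrite -negb_or -mulf_eq0.
have sA : (1 < size A)%N by move: sD; rewrite eA size_scale.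
(* F is monic, so the leading coefficients of A and B1 are constants that are
   inverse to each other, and both factors can be made monic. *)
have lead1 : lead_coef B1 * lead_coef A = 1.
  by rewrite -lead_coefM -eFAB; apply/monicP.
pose u := lead_coef A; pose v := lead_coef B1.
have mA : v *: A \is monic by rewrite monicE lead_coefZ lead1.
have mB : u *: B1 \is monic by rewrite monicE lead_coefZ mulrC lead1.
have eF2 : F = (v *: A) * (u *: B1).
  by rewrite -scalerAl -scalerAr scalerA lead1 scale1r mulrC.
have u0 : u != 0 by rewrite lead_coef_eq0.
have v0 : v != 0 by rewrite lead_coef_eq0.
have sAB : (size A + size B1).-1 = d.+2 by rewrite -sF eFAB mulrC size_mul.
have sB : (size B1 <= 1)%N.
  rewrite leqNgt; apply/negP => sB.
  have sA' : size (v *: A) = (size A).-2.+2.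
    by rewrite size_scale //; case: (size A) sA => [|[]].
  have sB' : size (u *: B1) = (size B1).-2.+2.
    by rewrite size_scale //; case: (size B1) sB => [|[]].
  have dE : d.+1 = ((size A).-2.+1 + (size B1).-2.+1)%N.
    by move: sA sB sAB; move: (size A) (size B1); clear => x y; lia.
  apply: (factors_meet mA mB sA' sB' (F' := F')); rewrite -?eF2 -?dE //.
  by apply: weighted_of_reverse eF'; rewrite sF.
have {}eFA : F = v *: A.
  rewrite eF2 (_ : u *: B1 = 1) ?mulr1 //.
  have [c1 ec1] : exists c1, u *: B1 = c1%:P.
    by exists (u *: B1)`_0; apply: size1_polyC; rewrite size_scale.
  by move: mB; rewrite ec1 monicE lead_coefC => /eqP ->.
have [Q [R [eGQ sR]]] : exists Q R, G = Q * F + R /\ (size R < size F)%N.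
  exists (Pdiv.Ring.rdivp G F), (Pdiv.Ring.rmodp G F).
  by rewrite -Pdiv.RingMonic.rdivp_eq // Pdiv.Ring.ltn_rmodp // F0.
exists Q; rewrite eGQ (_ : R = 0) ?addr0 //.
apply/eqP; apply: contraTT sR => R0; rewrite -leqNgt.
have eR : (v * c') *: R = (C * e%:P - (v * c') *: Q) * F.
  have -> : R = G - Q * F by rewrite eGQ addrC addKr.
  rewrite scalerBr mulrBl scalerAl; congr (_ - _).
  rewrite -scalerA eG eA eFA -!mul_polyC.
  by rewrite mulrCA -[RHS]mulrA; congr (_ * _); exact: mulrCA.
have vc0 : v * c' != 0 by rewrite mulf_neq0.
rewrite -(size_scale R vc0) eR size_mul // ?sF; last first.
  apply: contraNneq R0 => h; rewrite h mul0r in eR.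
  by move/eqP: eR; rewrite -mul_polyC mulf_eq0 polyC_eq0 (negPf vc0).
have : C * e%:P - (v * c') *: Q != 0.
  apply: contraNneq R0 => h; rewrite h mul0r in eR.
  by move/eqP: eR; rewrite -mul_polyC mulf_eq0 polyC_eq0 (negPf vc0).
by rewrite -size_poly_gt0; move: (size _); clear => x; lia.
Qed.

End Bivariate.

(** * Forms in three variables *)

Section Forms.

Variable K : fieldType.
Implicit Types (f g : {mpoly K[3]}) (P Q L v w u : 'rV[K]_3).

Lemma pevalM f g P : peval (f * g) P = peval f P * peval g P.
Proof. exact: mevalM. Qed.

Lemma pevalD f g P : peval (f + g) P = peval f P + peval g P.
Proof. exact: mevalD. Qed.

Lemma pevalB f g P : peval (f - g) P = peval f P - peval g P.
Proof. exact: mevalB. Qed.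

Lemma pevalZ c f P : peval (c *: f) P = c * peval f P.
Proof. exact: mevalZ. Qed.

Lemma peval0 P : peval 0 P = 0.
Proof. exact: meval0. Qed.

Lemma pevalX i P : peval 'X_i P = P 0 i.
Proof. exact: mevalXU. Qed.

Lemma peval_sum I (r : seq I) (F : I -> {mpoly K[3]}) P :
  peval (\sum_(i <- r) F i) P = \sum_(i <- r) peval (F i) P.
Proof. exact: (raddf_sum (meval (P 0))). Qed.

Lemma pevalXn f k P : peval (f ^+ k) P = peval f P ^+ k.
Proof. exact: (rmorphXn (meval (P 0))). Qed.

Lemma peval_homog d f c P : f \is d.-homog -> peval f (c *: P) = c ^+ d * peval f P.
Proof.
move=> /dhomogP hf; rewrite /peval !mevalE mulr_sumr; apply: eq_big_seq => m /hf.
rewrite /= => <-; rewrite mdegE -prodrXr mulrCA -big_split /=; congr (_ * _).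
by apply: eq_bigr => i _; rewrite mxE exprMn.
Qed.

Lemma mderiv_homog d f i : f \is d.+1.-homog -> f^`M(i) \is d.-homog.
Proof.
move=> /dhomogP hf; apply/dhomogP => m; rewrite mcoeff_msupp mcoeff_mderiv => h.
have : (m + U_(i))%MM \in msupp f.
  by rewrite mcoeff_msupp; apply: contraNneq h => ->; rewrite mul0rn.
by move/hf; rewrite /= mdegD mdeg1 addn1 => -[].
Qed.

Definition dot L v : K := \sum_i L 0 i * v 0 i.

Lemma incidentE L v : incident L v <-> dot L v = 0.
Proof.
have e : L *m v^T = (dot L v)%:M.
  rewrite [LHS]mx11_scalar; congr (_%:M); rewrite mxE.
  by apply: eq_bigr => i _; rewrite mxE.
rewrite /incident e; split=> [/matrixP/(_ 0 0)|->]; rewrite ?mxE ?mulr1n //.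
by apply/matrixP=> i j; rewrite !mxE mul0rn.
Qed.

Lemma dotC L v : dot L v = dot v L.
Proof. by apply: eq_bigr => i _; rewrite mulrC. Qed.

Lemma dotDr L v w : dot L (v + w) = dot L v + dot L w.
Proof. by rewrite -big_split; apply: eq_bigr => i _; rewrite mxE mulrDr. Qed.

Lemma dotZr L c v : dot L (c *: v) = c * dot L v.
Proof. by rewrite mulr_sumr; apply: eq_bigr => i _; rewrite mxE mulrCA. Qed.

Lemma dotDl L v w : dot (v + w) L = dot v L + dot w L.
Proof. by rewrite ![dot _ L]dotC dotDr. Qed.

Lemma dotZl L c v : dot (c *: v) L = c * dot v L.
Proof. by rewrite ![dot _ L]dotC dotZr. Qed.

Lemma dot_delta L i : dot L (delta_mx 0 i) = L 0 i.
Proof.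
rewrite /dot (bigD1 i) //= mxE !eqxx mulr1 big1 ?addr0 // => j ji.
by rewrite mxE (negPf ji) andbF mulr0.
Qed.

Lemma dot0r L : dot L 0 = 0.
Proof. by rewrite -(scale0r (0 : 'rV_3)) dotZr mul0r. Qed.

Lemma rV_neq0 L : L != 0 -> exists i, L 0 i != 0.
Proof.
move=> L0; apply/existsP; rewrite -negb_forall; apply: contra L0 => /forallP h.
by apply/eqP/rowP=> i; rewrite mxE; apply/eqP; move: (h i).
Qed.

Lemma dot_neq0 L : L != 0 -> exists v, dot L v != 0.
Proof. by case/rV_neq0=> i Li; exists (delta_mx 0 i); rewrite dot_delta. Qed.

(** The dual statement, that two lines meet, is the same one, since lines and
points are both row vectors. *)
Lemma line_through P Q : exists2 L, L != 0 & dot L P = 0 /\ dot L Q = 0.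
Proof.
pose M := col_mx P Q; have : kermx M^T != 0.
  rewrite kermx_eq0 /row_free; apply/negP => /eqP h.
  by have := rank_leq_row M; rewrite -mxrank_tr h.
case/rowV0Pn=> L /sub_kermxP; rewrite tr_col_mx mul_mx_row => LM L0.
have /eq_row_mx[LP LQ] : row_mx (L *m P^T) (L *m Q^T) = row_mx 0 0.
  by rewrite LM row_mx0.
by exists L => //; split; apply/incidentE.
Qed.

(** The restriction of f to the line through P in the direction v. All differential
calculus below is done on such restrictions. *)
Definition line f P v : {poly K} :=
  mmap (@polyC K) (fun i => (P 0 i)%:P + (v 0 i)%:P * 'X) f.

Lemma horner_line f P v t : (line f P v).[t] = peval f (P + t *: v).
Proof.
rewrite /line /peval /meval /mmap horner_sum; apply: eq_bigr => m _.
rewrite hornerM hornerC; congr (_ * _).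
rewrite /mmap1 horner_prod; apply: eq_bigr => i _.
by rewrite horner_exp hornerD hornerM !hornerC hornerX !mxE [_ * t]mulrC.
Qed.

Lemma lineD f g P v : line (f + g) P v = line f P v + line g P v.
Proof. exact: mmapD. Qed.

Lemma lineM f g P v : line (f * g) P v = line f P v * line g P v.
Proof. exact: rmorphM. Qed.

(** Both sides are derivations in f, so it suffices to compare them on constants and
variables. *)
Lemma deriv_line f P v :
  (line f P v)^`() = \sum_i line f^`M(i) P v * (v 0 i)%:P.
Proof.
pose D g := (line g P v)^`() - \sum_i line g^`M(i) P v * (v 0 i)%:P.
have DM g h : D g = 0 -> D h = 0 -> D (g * h) = 0.
  move=> /eqP; rewrite subr_eq0 => /eqP dg /eqP; rewrite subr_eq0 => /eqP dh.
  apply/eqP; rewrite subr_eq0; apply/eqP; rewrite lineM derivM dg dh.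
  rewrite mulr_suml mulr_sumr -big_split; apply: eq_bigr => i _ /=.
  by rewrite mderivM lineD !lineM; ring.
have DX m : D 'X_[m] = 0.
  rewrite mpolyXE_id; apply: (big_ind (fun g => D g = 0)) => [|g h|i _].
  - rewrite /D /line rmorph1 derivC big1 ?subr0 // => i _.
    by rewrite -mpolyC1 mderivC mmap0 mul0r.
  - exact: DM.
  elim: (m i) => [|k IH]; last first.
    rewrite exprS; apply: DM => //; rewrite /D /line mmapX mmap1U derivD derivC.
    rewrite deriv_mulC derivX mulr1 add0r (bigD1 i) //= big1 ?addr0.
      rewrite mderivX mnm1E eqxx scale1r -[X in (X - _)%MM]add0m addmK mpolyX0.
      by rewrite rmorph1 mul1r subrr.
    move=> j ji; rewrite mderivX mnm1E (negPf (_ : i != j)) ?scale0r ?mmap0 ?mul0r //.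
    by rewrite eq_sym.
  rewrite expr0 /D /line rmorph1 derivC big1 ?subr0 // => j _.
  by rewrite -mpolyC1 mderivC mmap0 mul0r.
apply/eqP; rewrite -subr_eq0 -/(D f); apply/eqP.
elim/mpolyind: f => [|c m f _ _ IH].
  by rewrite /D /line mmap0 linear0 big1 ?subr0 // => i _; rewrite linear0 mmap0 mul0r.
have eD g h : D (c *: g + h) = c%:P * D g + D h.
  rewrite /D /line mmapD mmapZ derivD deriv_mulC.
  under eq_bigr => i _ do rewrite mderivD mderivZ mmapD mmapZ mulrDl -mulrA.
  by rewrite big_split -mulr_sumr /=; ring.
by rewrite eD DX mulr0 IH addr0.
Qed.

Lemma horner_deriv_line f P v t :
  (line f P v)^`().[t] = dot (gradient f (P + t *: v)) v.
Proof.
rewrite deriv_line horner_sum; apply: eq_bigr => i _.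
by rewrite hornerM hornerC horner_line mxE.
Qed.

Lemma horner_deriv_line0 f P v : (line f P v)^`().[0] = dot (gradient f P) v.
Proof. by rewrite horner_deriv_line scale0r addr0. Qed.

End Forms.

(** * Frames and directional derivatives *)

Section Frames.

Variable K : fieldType.
Implicit Types (P Q L v w u O : 'rV[K]_3).

(** For nonzero vectors this is inequality of projective points. *)
Definition nonparallel v O := forall c, v <> c *: O.

Definition frame u v O := forall P, exists x y z, P = y *: v + x *: u + z *: O.

Lemma frameC u v O : frame u v O -> frame v u O.
Proof.
by move=> fr P; have [x [y [z ->]]] := fr P; exists y, x, z; rewrite [X in X + _]addrC.
Qed.

(** The functionals O_i x_j - O_j x_i have the multiples of O as common zeros. *)
Lemma nonparallel_dot v O : nonparallel v O -> exists2 L, dot L O = 0 & dot L v != 0.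
Proof.
move=> np; have [O0|/rV_neq0[i Oi]] := eqVneq O 0.
  have [L Lv] : exists L, dot v L != 0.
    by apply: dot_neq0; apply/eqP => v0; apply: (np 0); rewrite v0 scale0r.
  by exists L; rewrite ?O0 ?dot0r // dotC.
pose L j := O 0 i *: delta_mx 0 j - O 0 j *: delta_mx 0 i : 'rV[K]_3.
have LE j w : dot (L j) w = O 0 i * w 0 j - O 0 j * w 0 i.
  by rewrite /L -scaleNr dotDl !dotZl ![dot (delta_mx _ _) _]dotC !dot_delta mulNr.
have [/existsP[j Lj]|] := boolP [exists j, dot (L j) v != 0].
  by exists (L j) => //; rewrite LE mulrC subrr.
rewrite negb_exists => /forallP h; case: (np (v 0 i / O 0 i)).
apply/rowP=> j; rewrite mxE; move: (h j); rewrite negbK LE subr_eq0 => /eqP e.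
by apply: (mulfI Oi); rewrite e; field.
Qed.

Lemma frame_intro L M u v O : O != 0 -> dot M O = 0 -> dot M u != 0 ->
  dot L O = 0 -> dot L u = 0 -> dot L v != 0 -> frame u v O.
Proof.
move=> O0 MO Mu LO Lu Lv P.
pose B : 'M[K]_(1 + 1 + 1, 3) := col_mx (col_mx v u) O.
have Bfree : row_free B.
  rewrite -kermx_eq0; apply/negPn/negP=> /rowV0Pn[w /sub_kermxP].
  rewrite -[w]hsubmxK -[lsubmx w]hsubmxK mul_row_col mul_row_col.
  move: (lsubmx _) (rsubmx _) (rsubmx _) => y z x.
  rewrite [y]mx11_scalar [z]mx11_scalar [x]mx11_scalar !mul_scalar_mx.
  move: (y 0 0) (z 0 0) (x 0 0) => {y z x} y z x e.
  have := congr1 (dot L) e; rewrite !dotDr !dotZr Lu LO !mulr0 !addr0 dot0r.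
  move/eqP; rewrite mulf_eq0 (negPf Lv) orbF => /eqP y0; rewrite y0 scale0r add0r in e.
  have := congr1 (dot M) e; rewrite !dotDr !dotZr MO !mulr0 !addr0 dot0r.
  move/eqP; rewrite mulf_eq0 (negPf Mu) orbF => /eqP x0; rewrite x0 scale0r add0r in e.
  move/eqP: e; rewrite scaler_eq0 (negPf O0) orbF => /eqP z0.
  by rewrite y0 x0 z0 !(raddf0, row_mx0) eqxx.
have [C eC] : exists C, P = C *m B.
  by apply/submxP; rewrite submx_full // row_full_unit -row_free_unit.
move: eC; rewrite -[C]hsubmxK -[lsubmx C]hsubmxK mul_row_col mul_row_col.
move: (lsubmx _) (rsubmx _) (rsubmx _) => y z x.
rewrite [y]mx11_scalar [z]mx11_scalar [x]mx11_scalar !mul_scalar_mx => ->.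
by exists (x 0 0), (y 0 0), (z 0 0).
Qed.

Lemma frame_exists v O : O != 0 -> nonparallel v O -> exists u, frame u v O.
Proof.
move=> O0 np; have [L L0 [Lv LO]] := line_through v O.
have [u Lu] := dot_neq0 L0; have [M MO Mv] := nonparallel_dot np.
by exists u; apply: frameC; apply: (frame_intro (L := L) (M := M)).
Qed.

Lemma frame_dot_eq0 u v O L : frame u v O ->
  dot L u = 0 -> dot L v = 0 -> dot L O = 0 -> L = 0.
Proof.
move=> fr Lu Lv LO; apply/rowP => i; rewrite mxE -dot_delta.
have [x [y [z ->]]] := fr (delta_mx 0 i).
by rewrite !dotDr !dotZr Lu Lv LO !mulr0 !addr0.
Qed.

Lemma frame_neq0 u v O a z : frame u v O -> v + a *: u + z *: O != 0.
Proof.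
move=> fr; apply/eqP => e; have [L L0 [Lu LO]] := line_through u O.
case/eqP: L0; apply: (frame_dot_eq0 fr) => //.
by have := congr1 (dot L) e; rewrite !dotDr !dotZr Lu LO !mulr0 !addr0 dot0r.
Qed.

End Frames.

Section Derivatives.

Variable K : closedFieldType.
Implicit Types (f g : {mpoly K[3]}) (P Q L v w u O : 'rV[K]_3).

Lemma horner_line0 f P v : (line f P v).[0] = peval f P.
Proof. by rewrite horner_line scale0r addr0. Qed.

(** The roles of P and O are exchanged by the reversal of the line, so the leading
coefficient of the restriction is the value at O. *)
Lemma line_homog d f P O : f \is d.-homog ->
  (size (line f P O) <= d.+1)%N /\ (line f P O)`_d = peval f O.
Proof.
move=> hf; rewrite -(horner_line0 f O P); apply: reverse_poly_size => a a0.
rewrite !horner_line -(peval_homog _ _ hf) scalerDr scalerA divff // scale1r.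
by rewrite addrC.
Qed.

Lemma euler d f P : f \is d.-homog -> dot (gradient f P) P = d%:R * peval f P.
Proof.
move=> hf; have e : line f 0 P = peval f P *: 'X^d.
  apply: (@poly_ext _ [::]) => t _.
  by rewrite horner_line add0r (peval_homog _ _ hf) hornerZ hornerXn mulrC.
have := horner_deriv_line f 0 P 1; rewrite add0r scale1r e derivZ derivXn.
by rewrite hornerZ hornerMn hornerXn expr1n mulrC => <-.
Qed.

(** Kronecker substitution: with B above the degree, x_i := t^(B^i) sends different
monomials of f to different powers of t, as in base B. *)
Lemma nonroot_exists f : f != 0 -> exists P, peval f P != 0.
Proof.
move=> f0; pose B := msize f; pose ex (m : 'X_{1..3}) := (\sum_i m i * B ^ i)%N.
pose h : {poly K} := mmap (@polyC K) (fun i : 'I_3 => 'X^(B ^ i)) f.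
have ex_inj m1 m2 : m1 \in msupp f -> m2 \in msupp f -> ex m1 = ex m2 -> m1 = m2.
  move=> /msize_mdeg_lt d1 /msize_mdeg_lt d2; rewrite -/B in d1 d2.
  have ltB (m : 'X_{1..3}) i : (mdeg m < B)%N -> (m i < B)%N.
    by apply: leq_ltn_trans; rewrite mdegE (bigD1 i) //= leq_addr.
  rewrite /ex !big_ord_recl !big_ord0 /= !addn0 expn0 !muln1 expn1.
  rewrite /bump /= !addn0 !addn1 => e; apply/mnmP => i.
  have m0 := ltB m1 ord0 d1; have n0 := ltB m2 ord0 d2.
  pose i1 : 'I_3 := lift ord0 ord0; pose i2 : 'I_3 := lift ord0 (lift ord0 ord0).
  have m1' := ltB m1 i1 d1; have n1' := ltB m2 i1 d2.
  have Bgt : (0 < B)%N by apply: leq_ltn_trans d1.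
  move: e; rewrite -/i1 -/i2 -mulnn !mulnA -!mulnDl => e.
  have e0 : m1 ord0 = m2 ord0.
    by have := congr1 (modn^~ B) e; rewrite !(addnC (_ ord0)) !modnMDl !modn_small.
  have {}e : (m1 i1 + m1 i2 * B = m2 i1 + m2 i2 * B)%N.
    by move/eqP: e; rewrite e0 eqn_add2l eqn_pmul2r // => /eqP.
  have e1 : m1 i1 = m2 i1.
    by have := congr1 (modn^~ B) e; rewrite !(addnC (_ i1)) !modnMDl !modn_small.
  have e2 : m1 i2 = m2 i2 by move/eqP: e; rewrite e1 eqn_add2l eqn_pmul2r // => /eqP.
  case: i => [[|[|[|//]]] lti]; [move: e0|move: e1|move: e2];
    by congr (m1 _ = m2 _); apply: val_inj.
have hE : h = \sum_(m <- msupp f) f@_m *: 'X^(ex m).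
  rewrite /h /mmap; apply: eq_bigr => m _; rewrite mul_polyC; congr (_ *: _).
  rewrite /mmap1 /ex -prodrXr; apply: eq_bigr => i _.
  by rewrite -exprM mulnC.
have h0 : h != 0.
  have mf : mlead f \in msupp f by rewrite mlead_supp.
  apply: contraNneq f0 => e; have := congr1 (fun p : {poly K} => p`_(ex (mlead f))) e.
  rewrite coef0 hE coef_sum (bigD1_seq (mlead f)) //= coefZ coefXn eqxx mulr1.
  rewrite big_seq_cond big1 ?addr0 => [/eqP|m /andP[mf' ne]].
    by rewrite mleadc_eq0.
  rewrite coefZ coefXn; case: eqP => [e'|]; rewrite ?mulr0 //.
  by case/eqP: ne; apply: ex_inj.
have [t ht] := closed_nonrootP _ h0.
exists (\row_i (t ^+ (B ^ i)%N)); apply: contraNneq ht => e; apply/rootP.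
rewrite -[RHS]e /h /peval /meval /mmap horner_sum; apply: eq_bigr => m _.
rewrite hornerM hornerC; congr (_ * _).
rewrite /mmap1 horner_prod; apply: eq_bigr => i _.
by rewrite horner_exp hornerXn mxE.
Qed.

Lemma closed_field_root (c : K) d : (0 < d)%N -> exists x, x ^+ d = c.
Proof.
move=> d0; have /closed_rootP[x] : size ('X^d - c%:P) != 1%N.
  by rewrite size_XnsubC //; case: d d0.
by rewrite /root !hornerE subr_eq0 => /eqP; exists x.
Qed.

Definition dirder v f : {mpoly K[3]} := \sum_i v 0 i *: f^`M(i).

Lemma peval_dirder v f P : peval (dirder v f) P = dot (gradient f P) v.
Proof. by rewrite peval_sum; apply: eq_bigr => i _; rewrite pevalZ mxE mulrC. Qed.

Lemma dirder_homog d v f : f \is d.+1.-homog -> dirder v f \is d.-homog.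
Proof. by move=> hf; apply: rpred_sum => i _; apply/dhomogZ/mderiv_homog. Qed.

Lemma dirderD v w f : dirder (v + w) f = dirder v f + dirder w f.
Proof. by rewrite -big_split; apply: eq_bigr => i _; rewrite mxE scalerDl. Qed.

Lemma dirderZ c v f : dirder (c *: v) f = c *: dirder v f.
Proof. by rewrite scaler_sumr; apply: eq_bigr => i _; rewrite mxE scalerA. Qed.

Lemma dirder_comm v w f : dirder v (dirder w f) = dirder w (dirder v f).
Proof.
have e (x y : 'rV[K]_3) : dirder x (dirder y f) =
    \sum_i \sum_j (x 0 i * y 0 j) *: f^`M(j)^`M(i).
  apply: eq_bigr => i _; rewrite /dirder (raddf_sum (mderiv i)) scaler_sumr.
  by apply: eq_bigr => j _; rewrite /= mderivZ scalerA.
rewrite !e exchange_big; apply: eq_bigr => i _; apply: eq_bigr => j _ /=.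
by rewrite mulrC mderiv_comm.
Qed.

Lemma dirder_addr v f g : dirder v (f + g) = dirder v f + dirder v g.
Proof. by rewrite -big_split; apply: eq_bigr => i _; rewrite mderivD scalerDr. Qed.

Lemma dirder0 v : dirder v 0 = 0 :> {mpoly K[3]}.
Proof. by rewrite /dirder big1 // => i _; rewrite linear0 scaler0. Qed.

Lemma dirder_delta i f : dirder (delta_mx 0 i) f = f^`M(i).
Proof.
rewrite /dirder (bigD1 i) //= mxE !eqxx scale1r big1 ?addr0 // => j ji.
by rewrite mxE (negPf ji) andbF scale0r.
Qed.

End Derivatives.

(** * Projection from a point off the curve, and Bezout's bound *)

Section Projection.

Variable K : closedFieldType.
Implicit Types (f g : {mpoly K[3]}) (P L v w u O : 'rV[K]_3).

(** The affine plane v + a u + z O: the parameter a runs through the lines of the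
pencil at O, except the line spanned by O and u, which is at infinity. *)
Definition chart u v O f : {poly {poly K}} :=
  mmap (polyC \o polyC)
    (fun i => ((v 0 i)%:P + (u 0 i)%:P * 'X)%:P + (O 0 i)%:P%:P * 'X) f.

Lemma eval2_chart u v O f a z :
  eval2 (chart u v O f) a z = peval f (v + a *: u + z *: O).
Proof.
rewrite /eval2 /fiber /chart /peval /meval /mmap rmorph_sum horner_sum.
apply: eq_bigr => m _; rewrite rmorphM hornerM /= map_polyC hornerC.
congr (_ * _); first exact: hornerC.
rewrite /mmap1 rmorph_prod horner_prod; apply: eq_bigr => i _.
rewrite rmorphXn horner_exp rmorphD rmorphM /= !map_polyC map_polyX /horner_eval /=.
by rewrite !hornerE !mxE; congr (_ ^+ _); rewrite /horner_eval !hornerE; ring.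
Qed.

Lemma fiber_chart u v O f a : fiber (chart u v O f) a = line f (v + a *: u) O.
Proof.
apply: (@poly_ext _ [::]) => z _; rewrite -/(eval2 _ a z) eval2_chart.
by rewrite horner_line.
Qed.

Lemma chart_section u v O f z : (chart u v O f).[z%:P] = line f (v + z *: O) u.
Proof.
apply: (@poly_ext _ [::]) => a _; rewrite horner_line addrAC -eval2_chart.
exact: horner_section.
Qed.

Lemma chart_reverse e u v O g a z : g \is e.-homog -> a != 0 ->
  eval2 (chart v u O g) a z = a ^+ e * eval2 (chart u v O g) a^-1 (z / a).
Proof.
move=> hg a0; rewrite !eval2_chart -(peval_homog _ _ hg) !scalerDr !scalerA.
by rewrite divff // scale1r mulrCA divff // mulr1 [u + _]addrC.
Qed.

(** The coefficient of z^d is f(O). *)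
Lemma chart_monic d u v O f : f \is d.-homog -> peval f O = 1 ->
  chart u v O f \is monic /\ size (chart u v O f) = d.+1.
Proof.
move=> hf fO; set F := chart u v O f.
have coefF j a : (F`_j).[a] = (line f (v + a *: u) O)`_j.
  by rewrite -fiber_chart coef_fiber.
have Fd : F`_d = 1.
  apply: (@poly_ext _ [::]) => a _; rewrite coefF hornerC -fO.
  by have [_] := line_homog (v + a *: u) O hf.
have sF : size F = d.+1.
  apply/eqP; rewrite eqn_leq; apply/andP; split.
    apply/leq_sizeP => j dj; apply: (@poly_ext _ [::]) => a _; rewrite coefF horner0.
    have [s _] := line_homog (v + a *: u) O hf.
    by rewrite nth_default // (leq_trans s).
  rewrite ltnNge; apply/negP => s; move: Fd; rewrite nth_default //.
  by move/esym/eqP; rewrite oner_eq0.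
by rewrite monicE lead_coefE sF Fd.
Qed.

Lemma line_monic d f w O : f \is d.-homog -> peval f O = 1 ->
  line f w O \is monic /\ size (line f w O) = d.+1.
Proof.
move=> hf fO; have [mF sF] := chart_monic 0 w hf fO.
have -> : line f w O = fiber (chart 0 w O f) 0 by rewrite fiber_chart scale0r addr0.
by rewrite fiber_monic ?size_fiber.
Qed.

(** The line spanned by O and w contains a common zero of f and g different from O. *)
Definition meets f g O w := exists z, peval f (w + z *: O) = 0 /\ peval g (w + z *: O) = 0.

Definition fiber_norm f g O w := \prod_(z <- roots_of (line f w O)) peval g (w + z *: O).

Lemma fiber_norm_chart f g u v O a : fiber_norm f g O (v + a *: u) =
  \prod_(z <- roots_of (fiber (chart u v O f) a)) eval2 (chart u v O g) a z.
Proof.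
by rewrite /fiber_norm fiber_chart; apply: eq_bigr => z _; rewrite eval2_chart.
Qed.

Lemma fiber_norm_eq0 d f g O w : f \is d.-homog -> peval f O = 1 ->
  fiber_norm f g O w = 0 <-> meets f g O w.
Proof.
move=> hf fO; have [mF _] := chart_monic 0 w hf fO.
have := fiber_norm_chart f g 0 w O 0; rewrite scale0r addr0 => ->.
split=> [/eqP/(norm_eq0P _ _ mF)|] [z].
  by rewrite !eval2_chart scale0r addr0 => h; exists z.
move=> h; apply/eqP/(norm_eq0P _ _ mF); exists z.
by rewrite !eval2_chart scale0r addr0.
Qed.

Lemma fiber_normM f g h O w :
  fiber_norm f (g * h) O w = fiber_norm f g O w * fiber_norm f h O w.
Proof. by rewrite -big_split; apply: eq_bigr => z _; rewrite pevalM. Qed.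

(** Exchanging u and v reads the same binary form of degree d.+1 * e in the other
coordinate; its leading coefficient is the norm on the line at infinity. *)
Lemma fiber_norm_poly d e f g u v O : f \is d.+1.-homog -> peval f O = 1 ->
  g \is e.-homog -> exists P : {poly K},
    [/\ forall a, P.[a] = fiber_norm f g O (v + a *: u),
        (size P <= (d.+1 * e).+1)%N & P`_(d.+1 * e) = fiber_norm f g O u].
Proof.
move=> hf fO hg; have [mF sF] := chart_monic u v hf fO.
have [mF' sF'] := chart_monic v u hf fO.
have [|P eP] := norm_poly (chart u v O g) mF; first by rewrite sF.
have [|P' eP'] := norm_poly (chart v u O g) mF'; first by rewrite sF'.
have [] := @reverse_poly_size _ P P' (d.+1 * e).
  move=> a a0; rewrite eP eP'; apply: norm_reverse => // z; exact: chart_reverse.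
move=> sP cP; exists P; split=> // [a|]; first by rewrite fiber_norm_chart eP.
by rewrite cP eP' -fiber_norm_chart scale0r addr0.
Qed.

(** At a common zero P of two factors, the derivatives of their product vanish in the
directions O and u of the chart, and in the direction P by Euler; these three
directions span. *)
Lemma smooth_factors_disjoint d f u v O : smooth f -> f \is d.-homog ->
  frame u v O -> factors_disjoint (chart u v O f).
Proof.
move=> smf hf fr A B a z eF Az Bz; set P := v + a *: u + z *: O.
have fP : peval f P = 0 by rewrite -eval2_chart eF eval2M Az mulr0.
have P0 : P != 0 := frame_neq0 a z fr.
have dO : dot (gradient f P) O = 0.
  rewrite -horner_deriv_line -fiber_chart eF fiberM derivM hornerD !hornerM.
  by rewrite -/(eval2 A a z) -/(eval2 B a z) Az Bz mul0r mulr0 addr0.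
have du : dot (gradient f P) u = 0.
  have -> : P = v + z *: O + a *: u by rewrite addrAC.
  rewrite -horner_deriv_line -chart_section eF hornerM derivM hornerD !hornerM.
  by rewrite !horner_section Az Bz mul0r mulr0 addr0.
have dv : dot (gradient f P) v = 0.
  have := euler P hf; rewrite fP mulr0 {2}/P !dotDr !dotZr dO du !mulr0.
  by rewrite !addr0.
have /eqP := smf P (conj P0 fP); apply; exact: frame_dot_eq0 fr _ _ _.
Qed.

Lemma chart_dvd d e f g u v O : smooth f -> f \is d.+1.-homog -> peval f O = 1 ->
  g \is e.-homog -> frame u v O -> (forall a, meets f g O (v + a *: u)) ->
  exists Q, chart u v O g = Q * chart u v O f.
Proof.
move=> smf hf fO hg fr com; have [mF sF] := chart_monic u v hf fO.
apply: (dvd_of_common_zero_in_fibers mF sF (F' := chart v u O f)).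
- by move=> a z a0; apply: chart_reverse.
- exact: (smooth_factors_disjoint smf hf fr).
- exact: (smooth_factors_disjoint smf hf (frameC fr)).
by move=> a; have [z] := com a; exists z; rewrite !eval2_chart.
Qed.

(** Every line through O contains a common zero of f and g. For a smooth f this means
that g vanishes on the whole curve; [covers_gradient] and [covers_low_degree] give
the consequences that are used. *)
Definition covers f g := exists O, peval f O = 1 /\
  forall w, nonparallel w O -> meets f g O w.

Lemma meets_scale d e f g O y w z : f \is d.-homog -> g \is e.-homog -> y != 0 ->
  meets f g O w -> meets f g O (y *: w + z *: O).
Proof.
move=> hf hg y0 [z1 [fz gz]]; exists (y * z1 - z).
have -> : y *: w + z *: O + (y * z1 - z) *: O = y *: (w + z1 *: O).
  by rewrite -addrA -scalerDl [z + _]addrC subrK scalerDr scalerA.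
by rewrite (peval_homog _ _ hf) (peval_homog _ _ hg) fz gz !mulr0.
Qed.

(** One chart of the pencil at O suffices: the remaining line is the one at
infinity, where the norm is the leading coefficient of the norm polynomial, and a
line is unchanged when w is scaled or translated along O. *)
Lemma covers_of_norm_eq0 d e f g u v O : f \is d.+1.-homog -> peval f O = 1 ->
  g \is e.-homog -> frame u v O ->
  (forall a, meets f g O (v + a *: u)) -> covers f g.
Proof.
move=> hf fO hg fr com; exists O; split=> // w npw.
have mu : meets f g O u.
  have [P [eP _ cP]] := fiber_norm_poly u v hf fO hg.
  apply/(fiber_norm_eq0 _ _ hf fO); rewrite -cP.
  suff -> : P = 0 by rewrite coef0.
  apply: (@poly_ext _ [::]) => a _; rewrite eP horner0.
  by apply/(fiber_norm_eq0 _ _ hf fO).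
have [x [y [z ew]]] := fr w.
have [y0|y0] := eqVneq y 0; last first.
  have -> : w = y *: (v + (x / y) *: u) + z *: O.
    by rewrite ew scalerDr scalerA [y * _]mulrC divfK.
  exact: (meets_scale _ hf hg).
have [x0|x0] := eqVneq x 0.
  by case: (npw z); rewrite ew x0 y0 !scale0r !add0r.
by rewrite ew y0 scale0r add0r; exact: (meets_scale _ hf hg).
Qed.

Lemma form_neq0_at_O d f O : f \is d.+1.-homog -> peval f O = 1 -> O != 0.
Proof.
move=> hf; apply: contra_eqN => /eqP ->.
by rewrite -(scale0r (0 : 'rV[K]_3)) (peval_homog _ _ hf) expr0n mul0r eq_sym oner_eq0.
Qed.

Lemma zero_locus_nonparallel d f O P : f \is d.+1.-homog -> peval f O = 1 ->
  zero_locus f P -> nonparallel P O.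
Proof.
move=> hf fO [P0 fP] c eP; move/eqP: fP.
rewrite eP (peval_homog _ _ hf) fO mulr1 expf_eq0 /= => /eqP c0.
by move: P0; rewrite eP c0 scale0r eqxx.
Qed.

(** In a chart around P, g = Q f, so that the first-order data of g at P are Q(P) times
those of f. *)
Lemma covers_gradient d e f g P : smooth f -> f \is d.+1.-homog ->
  g \is e.-homog -> covers f g -> zero_locus f P ->
  peval g P = 0 /\ exists c, gradient g P = c *: gradient f P.
Proof.
move=> smf hf hg [O [fO com]] CP; have O0 := form_neq0_at_O hf fO.
have npP := zero_locus_nonparallel hf fO CP; have [P0 fP] := CP.
have [u fr] := frame_exists O0 npP.
have npa a : nonparallel (P + a *: u) O.
  move=> c e1; have /eqP := frame_neq0 a (- c) fr; apply.
  by rewrite e1 scaleNr subrr.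
have [Q eQ] := chart_dvd smf hf fO hg fr (fun a => com _ (npa a)).
have ev0 h : eval2 (chart u P O h) 0 0 = peval h P.
  by rewrite eval2_chart !scale0r !addr0.
have gP : peval g P = 0 by rewrite -ev0 eQ eval2M ev0 fP mulr0.
split=> //; exists (eval2 Q 0 0); apply/eqP; rewrite -subr_eq0; apply/eqP.
have fib h : fiber (chart u P O h) 0 = line h P O.
  by rewrite fiber_chart scale0r addr0.
have sec h : (chart u P O h).[0%:P] = line h P u.
  by rewrite chart_section scale0r addr0.
rewrite -scaleNr; apply: (frame_dot_eq0 fr); rewrite dotDl dotZl.
- rewrite -!horner_deriv_line0 -!sec eQ hornerM derivM hornerD !hornerM.
  by rewrite !horner_section ev0 fP mulr0 add0r mulNr subrr.
- by rewrite (euler P hf) (euler P hg) fP gP !mulr0 addr0.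
- rewrite -!horner_deriv_line0 -!fib eQ fiberM derivM hornerD !hornerM.
  by rewrite -!/(eval2 _ 0 0) ev0 fP mulr0 add0r mulNr subrr.
Qed.

(** In a chart, g is a multiple of f although its degree in z is smaller. *)
Lemma covers_low_degree d e f g : smooth f -> f \is d.+1.-homog ->
  g \is e.-homog -> (e < d.+1)%N -> covers f g -> g = 0.
Proof.
move=> smf hf hg ed [O [fO com]]; have O0 := form_neq0_at_O hf fO.
apply/eqP; apply/negPn/negP => g0.
have [i Oi] := rV_neq0 O0; pose j : 'I_3 := if i == 0 then 1 else 0.
have ji : (j == i) = false by rewrite /j; case: (eqVneq i 0) => [->|/negPf <-]; rewrite // eq_sym.
(* The linear form h vanishes at O, so that a point where g * h is nonzero is not
   parallel to O and lies in some chart. *)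
pose h : {mpoly K[3]} := O 0 i *: 'X_j - O 0 j *: 'X_i.
have hE w : peval h w = O 0 i * w 0 j - O 0 j * w 0 i.
  by rewrite pevalB !pevalZ !pevalX.
have h0 : h != 0.
  apply: contraNneq Oi => e0; have := hE (delta_mx 0 j).
  rewrite e0 peval0 !mxE !eqxx eq_sym ji.
  by rewrite andbF mulr0 subr0 mulr1 => <-.
have [w] := nonroot_exists (mulf_neq0 g0 h0); rewrite pevalM mulf_eq0 negb_or.
case/andP=> gw hw; have npw : nonparallel w O.
  move=> c ew; case/eqP: hw; rewrite hE ew !mxE; ring.
have [u fr] := frame_exists O0 npw.
have npa a : nonparallel (w + a *: u) O.
  move=> c e1; have /eqP := frame_neq0 a (- c) fr; apply.
  by rewrite e1 scaleNr subrr.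
have [Q eQ] := chart_dvd smf hf fO hg fr (fun a => com _ (npa a)).
have := congr1 (fun G => @fiber K G 0) eQ; rewrite /= fiberM !fiber_chart scale0r addr0 => eL.
have [mL sL] := line_monic w hf fO; have [sg _] := line_homog w O hg.
have [Q0|Q0] := eqVneq (fiber Q 0) 0.
  by move: gw; rewrite -(horner_line0 g w O) eL Q0 mul0r horner0 eqxx.
move: sg; rewrite eL size_Mmonic // sL addnS /= leqNgt => /negP; apply.
move: Q0; rewrite -size_poly_gt0; move: (size _) ed; clear => s; lia.
Qed.

Definition linform L : {mpoly K[3]} := \sum_i L 0 i *: 'X_i.

Lemma peval_linform L w : peval (linform L) w = dot L w.
Proof. by rewrite peval_sum; apply: eq_bigr => i _; rewrite pevalZ pevalX. Qed.

Lemma linform_neq0 L : L != 0 -> linform L != 0.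
Proof.
case/dot_neq0=> v; rewrite -peval_linform; apply: contraNneq => ->.
by rewrite peval0.
Qed.

Lemma peval_prod I (r : seq I) (F : I -> {mpoly K[3]}) P :
  peval (\prod_(i <- r) F i) P = \prod_(i <- r) peval (F i) P.
Proof. exact: (rmorph_prod (meval (P 0))). Qed.

(** Bezout's bound, without multiplicities. The centre O and the chart are chosen such
that the points of the family lie on different lines through O, none of them at
infinity; their parameters are then more than d.+1 * e roots of the norm
polynomial. *)
Lemma bezout_covers (I : finType) (pts : I -> 'rV[K]_3) d e f g :
  f \is d.+1.-homog -> f != 0 -> g \is e.-homog ->
  (forall i, zero_locus f (pts i)) -> (forall i, peval g (pts i) = 0) ->
  (forall i j, i != j -> nonparallel (pts i) (pts j)) ->
  (d.+1 * e < #|I|)%N -> covers f g.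
Proof.
move=> hf f0 hg Cp gp np big.
(* The lines L are those joining two points of the family: O will be on none of
   them. The lines M join O to a point of the family: u will be on none of them, so that
   no point of the family is on the line at infinity. *)
have lineij (ij : I * I) : exists L, L != 0 /\ dot L (pts ij.1) = 0 /\ dot L (pts ij.2) = 0.
  by have [L] := line_through (pts ij.1) (pts ij.2); exists L.
have [L L_] := fin_all_exists lineij.
have [O0 fO0 LO0] : exists2 O0, peval f O0 != 0 & forall ij, dot (L ij) O0 != 0.
  have : f * \prod_(ij : I * I) linform (L ij) != 0.
    rewrite mulf_neq0 //; apply/prodf_neq0 => ij _; apply: linform_neq0.
    by have [] := L_ ij.
  case/nonroot_exists=> O0; rewrite pevalM mulf_eq0 negb_or => /andP[fO0].
  rewrite peval_prod => /prodf_neq0 LO; exists O0 => // ij.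
  by rewrite -peval_linform LO.
have [O fO LO] : exists2 O, peval f O = 1 & forall ij, dot (L ij) O != 0.
  have [c ec] := closed_field_root (peval f O0)^-1 (ltn0Sn d).
  exists (c *: O0) => [|ij]; first by rewrite (peval_homog _ _ hf) ec mulVf.
  rewrite dotZr mulf_neq0 //; apply: contraNneq fO0 => c0.
  by move: ec; rewrite c0 expr0n => /esym/eqP; rewrite invr_eq0.
have On0 := form_neq0_at_O hf fO.
have throughO i : exists M, M != 0 /\ dot M O = 0 /\ dot M (pts i) = 0.
  by have [M] := line_through O (pts i); exists M.
have [M M_] := fin_all_exists throughO.
have [u Mu] : exists u, forall i, dot (M i) u != 0.
  have : \prod_i linform (M i) != 0.
    by apply/prodf_neq0 => i _; apply: linform_neq0; have [] := M_ i.
  case/nonroot_exists=> u; rewrite peval_prod => /prodf_neq0 h; exists u => i.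
  by rewrite -peval_linform h.
have [N N0 [NO Nu]] := line_through O u; have [v Nv] := dot_neq0 N0.
have [i0 _] : exists i0 : I, true.
  have /card_gt0P[i0 _] : (0 < #|I|)%N by apply: leq_ltn_trans big.
  by exists i0.
have fr : frame u v O.
  by apply: (frame_intro (L := N) (M := M i0)) => //; have [_ []] := M_ i0.
have coord i : exists t, (t.1.1 != 0) /\ pts i = t.1.1 *: (v + t.1.2 *: u + t.2 *: O).
  have [x [y [z e1]]] := fr (pts i).
  have [y0|y0] := eqVneq y 0; last first.
    exists (y, x / y, z / y); split=> //=.
    by rewrite e1 !scalerDr !scalerA ![y * (_ / _)]mulrC !divfK.
  have [_ [MO Mp]] := M_ i.
  have := congr1 (dot (M i)) e1; rewrite Mp y0 !dotDr !dotZr MO mul0r mulr0 addr0 add0r.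
  move/esym/eqP; rewrite mulf_eq0 (negPf (Mu i)) orbF => /eqP x0.
  case: (zero_locus_nonparallel hf fO (Cp i) (c := z)).
  by rewrite e1 x0 y0 !scale0r !add0r.
have [t t_] := fin_all_exists coord.
have a_inj : injective (fun i => (t i).1.2).
  move=> i j /= eij; apply/eqP/negPn/negP => nij.
  have [yi ei] := t_ i; have [yj ej] := t_ j.
  have [_ [/= Li Lj]] := L_ (i, j); have := LO (i, j).
  move: Li Lj; rewrite ei ej !dotZr => /eqP; rewrite mulf_eq0 (negPf yi) /= => /eqP Li.
  move=> /eqP; rewrite mulf_eq0 (negPf yj) /= => /eqP Lj LOij.
  have ez : (t i).2 = (t j).2.
    apply/eqP; rewrite -subr_eq0; apply/eqP; apply: (mulIf LOij); rewrite mul0r mulrBl.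
    move: Li Lj; rewrite !(dotDr _ (_ + _)) -eij !dotZr => /eqP.
    by rewrite addrC addr_eq0 => /eqP -> /eqP; rewrite addrC addr_eq0 => /eqP ->; rewrite subrr.
  apply: (np i j nij ((t i).1.1 / (t j).1.1)).
  by rewrite ei ej scalerA divfK // eij ez.
have [P [eP sP _]] := fiber_norm_poly u v hf fO hg.
apply: (covers_of_norm_eq0 hf fO hg fr) => a.
apply/(fiber_norm_eq0 _ _ hf fO); rewrite -eP.
suff -> : P = 0 by rewrite horner0.
apply/eqP/negPn/negP => P0.
have := @max_poly_roots _ P [seq (t i).1.2 | i <- enum I] P0.
rewrite map_inj_uniq // enum_uniq size_map -cardE => h.
suff : (#|I| < size P)%N by rewrite ltnNge (leq_trans sP).
apply: h => //; apply/allP => _ /mapP[i _ ->]; apply/rootP; rewrite eP.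
apply/(fiber_norm_eq0 _ _ hf fO); have [yi ei] := t_ i; exists (t i).2.
have [_ fi] := Cp i; move: fi (gp i); rewrite ei (peval_homog _ _ hf) (peval_homog _ _ hg).
by move=> /eqP; rewrite mulf_eq0 expf_eq0 (negPf yi) andbF => /eqP -> /eqP;
   rewrite mulf_eq0 expf_eq0 (negPf yi) andbF => /eqP ->.
Qed.

End Projection.

(** * The Hessian of a curve all of whose points are flexes *)

Section Hessian.

Variable K : closedFieldType.
Implicit Types (f g : {mpoly K[3]}) (P L v w u O : 'rV[K]_3).

Lemma peval_ext f g : (forall P, peval f P = peval g P) -> f = g.
Proof.
move=> e; apply/eqP; rewrite -subr_eq0; apply/negPn/negP=> /nonroot_exists[P].
by rewrite pevalB e subrr eqxx.
Qed.

Lemma unit_point_exists d f : f \is d.+1.-homog -> f != 0 -> exists O, peval f O = 1.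
Proof.
move=> hf /nonroot_exists[O0 fO0].
have [c ec] := closed_field_root (peval f O0)^-1 (ltn0Sn d).
by exists (c *: O0); rewrite (peval_homog _ _ hf) ec mulVf.
Qed.

Lemma frame_coordinate u v O : frame u v O ->
  exists N, [/\ dot N O = 0, dot N u = 0 & dot N v != 0].
Proof.
move=> fr; have [N N0 [NO Nu]] := line_through O u; exists N; split=> //.
by apply: contraNneq N0 => Nv; apply/eqP; apply: frame_dot_eq0 fr _ _ _.
Qed.

Lemma roots_of_line d f w O z : f \is d.-homog -> peval f O = 1 ->
  z \in roots_of (line f w O) -> peval f (w + z *: O) = 0.
Proof.
move=> hf fO; have [mL _] := line_monic w hf fO.
by rewrite mem_roots_of // => /rootP; rewrite horner_line.
Qed.

(** Finitely many nonzero linear forms have a common nonzero. *)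
Lemma smooth_avoid f (s : seq 'rV[K]_3) : smooth f ->
  (forall P, P \in s -> zero_locus f P) ->
  exists w, forall P, P \in s -> dot (gradient f P) w != 0.
Proof.
move=> smf Cs; have : \prod_(P <- s) linform (gradient f P) != 0.
  by rewrite prodf_seq_neq0; apply/allP => P /Cs /smf; apply: linform_neq0.
case/nonroot_exists=> w; rewrite peval_prod prodf_seq_neq0 => /allP h.
by exists w => P /h; rewrite peval_linform.
Qed.

Definition hessian f v w := dirder v (dirder w f).

Lemma hessian_homog d f v w : f \is d.+2.-homog -> hessian f v w \is d.-homog.
Proof. by move=> hf; do 2! apply: dirder_homog. Qed.

Lemma hessianC f v w : hessian f v w = hessian f w v.
Proof. exact: dirder_comm. Qed.

Lemma hessianDl f u v w : hessian f (u + v) w = hessian f u w + hessian f v w.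
Proof. exact: dirderD. Qed.

Lemma hessianDr f u v w : hessian f u (v + w) = hessian f u v + hessian f u w.
Proof. by rewrite !(hessianC f u) hessianDl. Qed.

Lemma hessianZl f c v w : hessian f (c *: v) w = c *: hessian f v w.
Proof. exact: dirderZ. Qed.

Lemma hessianZr f c v w : hessian f v (c *: w) = c *: hessian f v w.
Proof. by rewrite !(hessianC f v) hessianZl. Qed.

(** The tangent line at P meets the curve with multiplicity at least 3. *)
Definition flex f P := forall v, dot (gradient f P) v = 0 -> peval (hessian f v v) P = 0.

(** The vector (L u) w - (L w) u is tangent to the curve at P, for L the gradient; the
flex condition on this vector is the identity, rearranged so that the derivative of
f along w is a factor on the right. *)
Lemma flex_identity f P w u : flex f P ->
  peval (dirder u f ^+ 2 * hessian f w w) P =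
  peval (dirder w f * (2 *: (dirder u f * hessian f u w) - dirder w f * hessian f u u)) P.
Proof.
move=> /(_ (dot (gradient f P) u *: w - dot (gradient f P) w *: u)).
rewrite -scaleNr dotDr !dotZr mulNr mulrC subrr => /(_ erefl).
rewrite !(hessianDl, hessianDr, hessianZl, hessianZr) !(pevalD, pevalZ) (hessianC f w u).
rewrite pevalM pevalXn pevalM pevalB pevalZ !pevalM !peval_dirder => e.
by apply/eqP; rewrite -subr_eq0 -e; apply/eqP; ring.
Qed.

Section OneChart.

Variables (d : nat) (f : {mpoly K[3]}) (bad : seq 'rV[K]_3) (u v O : 'rV[K]_3).
Hypothesis smf : smooth f.
Hypothesis hf : f \is d.+2.-homog.
Hypothesis fO : peval f O = 1.
Hypothesis fr : frame u v O.
Hypothesis flexf : forall P, zero_locus f P ->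
  (forall b, b \in bad -> nonparallel P b) -> flex f P.

(** In terms of norms, [flex_identity] says that the norm P1 of the derivative L_w of f
along w divides P3^2 times the norm P2 of the second derivative, P3 being the norm
of the derivative along a second vector x. Since f is smooth, x can be chosen so that
P3 has no common root with P1. So P1 divides P2; but P1 has degree exactly
d.+2 * d.+1, as its value at infinity is nonzero by the choice of w, and P2 has degree
at most d.+2 * d. Hence P2 = 0, and the second derivative, whose degree is below that
of f, is zero. The points of bad only affect finitely many values of the parameter. *)
Lemma hessian_diag_eq0 w : fiber_norm f (dirder w f) O u != 0 -> hessian f w w = 0.
Proof.
move=> good; have hw := dirder_homog w hf; have hww := hessian_homog w w hf.
have [P1 [e1 s1 c1]] := fiber_norm_poly u v hf fO hw.
have [P2 [e2 s2 _]] := fiber_norm_poly u v hf fO hww.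
have P1n : P1`_(d.+2 * d.+1) != 0 by rewrite c1.
have P10 : P1 != 0 by apply: contraNneq P1n => ->; rewrite coef0.
have {s1} sP1 : size P1 = (d.+2 * d.+1).+1.
  apply/eqP; rewrite eqn_leq s1 ltnNge; apply: contraNN P1n => h.
  by rewrite nth_default.
have inC a z : z \in roots_of (line f (v + a *: u) O) ->
    zero_locus f (v + a *: u + z *: O).
  by move=> /(roots_of_line hf fO) h; split=> //; apply: frame_neq0 fr.
pose pts := [seq v + a *: u + z *: O | a <- roots_of P1,
                                      z <- roots_of (line f (v + a *: u) O)].
have [x gx] : exists x, forall P, P \in pts -> dot (gradient f P) x != 0.
  apply: smooth_avoid => // P /allpairsPdep[a [z [_ zr ->]]]; exact: inC.
pose g4 := 2 *: (dirder x f * hessian f x w) - dirder w f * hessian f x x.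
have hx := dirder_homog x hf.
have h4 : g4 \is (d.+1 + d).-homog.
  by rewrite rpredB ?rpredZ // dhomogM // hessian_homog.
have [P3 [e3 _ _]] := fiber_norm_poly u v hf fO hx.
have [P4 [e4 _ _]] := fiber_norm_poly u v hf fO h4.
have [N [NO Nu Nv]] := frame_coordinate fr.
have [M [MO Mv Mu]] := frame_coordinate (frameC fr).
have e1234 : P3 ^+ 2 * P2 = P1 * P4.
  (* The parameters of the lines joining O to the exceptional points, since the
     coordinates along v and u of a vector b are N b / N v and M b / M u. *)
  pose s := [seq (dot M b * dot N v) / (dot N b * dot M u) | b <- bad].
  apply: (@poly_ext _ s) => a nas.
  rewrite expr2 !hornerM e1 e2 e3 e4 -!fiber_normM -expr2.
  rewrite /fiber_norm; apply: eq_big_seq => z zr; apply: flex_identity.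
  apply: flexf; first exact: inC.
  move=> b bb c eb; case/negP: nas; apply/mapP; exists b => //.
  have := congr1 (dot N) eb; rewrite !dotDr !dotZr Nu NO !mulr0 !addr0 => Nb.
  have := congr1 (dot M) eb; rewrite !dotDr !dotZr Mv MO !mulr0 addr0 add0r => Mb.
  move: Nv; rewrite Nb mulf_eq0 negb_or => /andP[c0 Nb0].
  by apply: (mulIf Mu); rewrite Mb; field; rewrite Nb0 Mu.
have cop : coprimep P1 P3.
  apply/Pdiv.ClosedField.coprimepP => a ra; rewrite /root e3.
  rewrite /fiber_norm prodf_seq_neq0; apply/allP => z zr; rewrite peval_dirder /= gx //.
  apply/allpairsPdep; exists a, z; split=> //.
  have -> : a \in roots_of P1 = root P1 a; last by [].
  by rewrite [in RHS](roots_ofE P1) rootZ ?lead_coef_eq0 // root_prod_XsubC.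
have P20 : P2 = 0.
  apply/eqP/negPn/negP => P20; have : P1 %| P2.
    by rewrite -(@Gauss_dvdpr _ _ (P3 ^+ 2)) ?coprimep_expr // e1234 dvdp_mulr.
  move/(dvdp_leq P20); rewrite sP1 => /leq_trans/(_ s2).
  by rewrite ltnS leq_mul2l ltnn.
apply: (covers_low_degree smf hf hww); first by rewrite ltnS leqnSn.
apply: (covers_of_norm_eq0 hf fO hww fr) => a.
by apply/(fiber_norm_eq0 _ _ hf fO); rewrite -e2 P20 horner0.
Qed.

End OneChart.

(** The vectors w to which [hessian_diag_eq0] applies are dense: any w0 can be moved to
one by adding t w1 for almost all t. This extends the conclusion to all w, and
polarization, where 2 has to be invertible, to the bilinear form. *)
Theorem hessian_eq0 d f (bad : seq 'rV[K]_3) : smooth f -> f \is d.+2.-homog ->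
  f != 0 -> (2 : K) != 0 ->
  (forall P, zero_locus f P -> (forall b, b \in bad -> nonparallel P b) -> flex f P) ->
  forall v w, hessian f v w = 0.
Proof.
move=> smf hf f0 two flexf; have [O fO] := unit_point_exists hf f0.
have O0 := form_neq0_at_O hf fO.
have [u npu] : exists u, nonparallel u O.
  have [i Oi] := rV_neq0 O0; pose j : 'I_3 := if i == 0 then 1 else 0.
  have ij : (i == j) = false by rewrite /j; case: (eqVneq i 0) => [->|/negPf <-].
  exists (delta_mx 0 j) => c /rowP e; have := e i; have := e j.
  rewrite !mxE !eqxx ij /= => e1 /esym/eqP; rewrite mulf_eq0 (negPf Oi) orbF => /eqP c0.
  by move: e1; rewrite c0 mul0r => /eqP; rewrite oner_eq0.
have [v /frameC fr] := frame_exists O0 npu.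
have inC z : z \in roots_of (line f u O) -> zero_locus f (u + z *: O).
  move=> /(roots_of_line hf fO) h; split=> //.
  by have := frame_neq0 0 z (frameC fr); rewrite scale0r addr0.
have [w1 gw1] : exists w1, forall z, z \in roots_of (line f u O) ->
    dot (gradient f (u + z *: O)) w1 != 0.
  have [P /mapP[z zr ->]|w1 h] := @smooth_avoid f [seq u + z *: O | z <- roots_of (line f u O)] smf.
    exact: inC.
  by exists w1 => z zr; apply: h; apply: map_f.
have good w : (forall z, z \in roots_of (line f u O) ->
    dot (gradient f (u + z *: O)) w != 0) -> hessian f w w = 0.
  move=> gw; apply: (hessian_diag_eq0 smf hf fO fr flexf).
  by rewrite prodf_seq_neq0; apply/allP => z zr; rewrite /= peval_dirder gw.
have diag w : hessian f w w = 0.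
  apply: peval_ext => P; rewrite peval0.
  pose g z := gradient f (u + z *: O).
  (* For t outside s, [good] applies to w + t w1; the resulting polynomial identity
     in t is then evaluated at t = 0. *)
  pose s := [seq - (dot (g z) w / dot (g z) w1) | z <- roots_of (line f u O)].
  have e : (peval (hessian f w w) P)%:P + (2 * peval (hessian f w w1) P) *: 'X = 0.
    apply: (@poly_ext _ s) => t ts; rewrite hornerD hornerZ hornerX hornerC horner0.
    have : hessian f (w + t *: w1) (w + t *: w1) = 0.
      apply: good => z zr; apply: contraNneq ts; rewrite dotDr dotZr => h.
      apply/mapP; exists z => //; apply: (mulIf (gw1 z zr)).
      by rewrite mulNr divfK ?gw1 //; apply/eqP; rewrite -addr_eq0 addrC; apply/eqP.
    move/(congr1 (fun h : {mpoly K[3]} => peval h P)); rewrite peval0.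
    rewrite !(hessianDl, hessianDr, hessianZl, hessianZr) (good w1) // !scaler0 addr0.
    by rewrite (hessianC f w1) !pevalD !pevalZ => <-; ring.
  have := congr1 (fun p : {poly K} => p.[0]) e.
  by rewrite hornerD hornerC hornerZ hornerX mulr0 addr0 horner0.
move=> v' w; have := diag (v' + w).
rewrite hessianDl !hessianDr !diag add0r addr0 (hessianC f w) -mulr2n -scaler_nat => /eqP.
by rewrite scaler_eq0 (negPf two) => /eqP.
Qed.

End Hessian.

(** * Curves whose tangent at P contains the Frobenius conjugate of P *)

Section FrobeniusNonclassical.

Variable K : closedFieldType.
Implicit Types (f g h : {mpoly K[3]}) (P L v w u O : 'rV[K]_3).

Lemma dot_span L P Q w : L != 0 -> nonparallel Q P -> P != 0 ->
  dot L P = 0 -> dot L Q = 0 -> dot L w = 0 -> exists y z, w = y *: Q + z *: P.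
Proof.
move=> L0 np P0 LP LQ Lw; have [u fr] := frame_exists P0 np.
have Lu : dot L u != 0.
  by apply: contraNneq L0 => Lu; apply/eqP; apply: frame_dot_eq0 fr _ _ _.
have [x [y [z ew]]] := fr w; exists y, z.
move/eqP: Lw; rewrite ew !dotDr !dotZr LP LQ !mulr0 addr0 add0r mulf_eq0.
by rewrite (negPf Lu) orbF => /eqP ->; rewrite scale0r addr0.
Qed.

Definition frob_point q P : 'rV[K]_3 := \row_i P 0 i ^+ q.

(** It vanishes at a point P of the curve when the tangent at P contains the image of P
under the q-th power map. *)
Definition tangent_frob q f : {mpoly K[3]} := \sum_i 'X_i ^+ q * f^`M(i).

Lemma tangent_frob_homog q d f : f \is d.+1.-homog ->
  tangent_frob q f \is (q + d).-homog.
Proof.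
move=> hf; apply: rpred_sum => i _; apply: dhomogM; last exact: mderiv_homog.
by rewrite -[q in q.-homog]mul1n; apply: dhomogMn; rewrite dhomogX /= mdeg1.
Qed.

Lemma peval_tangent_frob q f P :
  peval (tangent_frob q f) P = dot (gradient f P) (frob_point q P).
Proof.
rewrite peval_sum; apply: eq_bigr => i _.
by rewrite pevalM pevalXn pevalX !mxE mulrC.
Qed.

Lemma mderiv_expn n (p : {mpoly K[n]}) i k :
  (p ^+ k)^`M(i) = k%:R *: (p ^+ k.-1 * p^`M(i)).
Proof.
case: k => [|k]; first by rewrite expr0 -mpolyC1 mderivC scale0r.
elim: k => [|k IH]; first by rewrite expr1 expr0 mul1r scale1r.
rewrite exprS mderivM IH -scalerAr mulrA -exprS -[k.+2]addn1 natrD scalerDl scale1r.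
by rewrite addn1 /= addrC mulrC.
Qed.

Lemma dirder_tangent_frob q f v P : q%:R = 0 :> K ->
  peval (dirder v (tangent_frob q f)) P = peval (hessian f (frob_point q P) v) P.
Proof.
move=> q0; rewrite /hessian [RHS]peval_dirder -peval_tangent_frob.
have -> : dirder v (tangent_frob q f) = \sum_i 'X_i ^+ q * (dirder v f)^`M(i).
  rewrite /tangent_frob (big_morph _ (dirder_addr v) (dirder0 v)).
  apply: eq_bigr => i _; rewrite /dirder (raddf_sum (mderiv i)) [RHS]mulr_sumr.
  apply: eq_bigr => j _; rewrite /= mderivZ mderivM mderiv_expn q0 scale0r mul0r.
  by rewrite add0r scalerAr mderiv_comm.
by [].
Qed.

(** Write Phi for the image of P. The gradient of the form sum x_i^q f_i at P is the
Hessian applied to Phi, because the derivatives of x_i^q are zero; it is parallel to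
the gradient of f by [covers_gradient]. The Hessian applied to P is zero by Euler. So
the Hessian form vanishes on the span of P and Phi, which is the tangent plane. *)
Lemma frobenius_flex q d f P : smooth f -> f \is d.+1.-homog ->
  d%:R = 0 :> K -> q%:R = 0 :> K -> covers f (tangent_frob q f) ->
  zero_locus f P -> nonparallel (frob_point q P) P -> flex f P.
Proof.
move=> smf hf d0 q0 cov CP np v gv; have [P0 fP] := CP.
have hD := tangent_frob_homog q hf.
have [DP [c gD]] := covers_gradient smf hf hD cov CP.
have gP : dot (gradient f P) P = 0 by rewrite (euler P hf) fP mulr0.
have gPhi : dot (gradient f P) (frob_point q P) = 0 by rewrite -peval_tangent_frob.
have HPhi w : peval (hessian f (frob_point q P) w) P = c * dot (gradient f P) w.
  by rewrite -dirder_tangent_frob // peval_dirder gD dotZl.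
have HP w : peval (hessian f P w) P = 0.
  by rewrite /hessian peval_dirder (euler P (dirder_homog w hf)) d0 mul0r.
have [y [z ->]] := dot_span (smf P CP) np P0 gP gPhi gv.
rewrite !(hessianDl, hessianDr, hessianZl, hessianZr) !(pevalD, pevalZ) !HPhi !HP gP gPhi.
by rewrite !(mulr0, addr0).
Qed.

Lemma pchar_mpoly p : p \in [pchar K] -> p \in [pchar {mpoly K[3]}].
Proof.
by move=> pK; rewrite inE (pcharf_prime pK) -mpolyC_nat (pcharf0 pK) mpolyC0 /=.
Qed.

(** The exponents of h are divisible by p, and its coefficients have p-th roots. *)
Lemma pth_root_form p k h : p \in [pchar K] -> h \is (p * k).-homog ->
  (forall i, h^`M(i) = 0) -> exists2 g, g \is k.-homog & h = g ^+ p.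
Proof.
move=> pK /dhomogP hh h'0; have p_pr := pcharf_prime pK.
have p0 := prime_gt0 p_pr.
have pm := pchar_mpoly pK.
have divm m i : m \in msupp h -> (p %| m i)%N.
  move=> mh; case mi: (m i) => [|n]; first exact: dvdn0.
  have em : m = (m - U_(i) + U_(i))%MM.
    by rewrite submK //; apply/mnm_lepP => j; rewrite mnm1E; case: eqP => // <-; rewrite mi.
  have := congr1 (mcoeff (m - U_(i))) (h'0 i).
  rewrite mcoeff_mderiv -em mcoeff0 mnmBE mnm1E eqxx mi subn1 /= -mulr_natr => /eqP.
  rewrite mulf_eq0 -[_ == 0]negbK -mcoeff_msupp mh /=.
  by rewrite (dvdn_pcharf pK).
have rootp (c : K) : {x | x ^+ p == c}.
  by apply: sigW; have [x /eqP xp] := closed_field_root c p0; exists x.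
pose mp (m : 'X_{1..3}) := [multinom (m i %/ p)%N | i < 3].
have mpK m : m \in msupp h -> (mp m *+ p)%MM = m.
  by move=> mh; apply/mnmP => i; rewrite mulmnE mnmE divnK // divm.
exists (\sum_(m <- msupp h) sval (rootp h@_m) *: 'X_[mp m]).
  rewrite big_seq; apply: rpred_sum => m mh; rewrite dhomogZ // dhomogX /=.
  have := hh m mh; rewrite /= -{1}(mpK m mh) mdegMn mulnC => /eqP.
  by rewrite eqn_pmul2l.
rewrite -(pFrobenius_autE pm) raddf_sum {1}[h]mpolyE.
apply: eq_big_seq => m mh /=.
by rewrite pFrobenius_autE exprZn (eqP (svalP (rootp _))) mpolyXn mpK.
Qed.

End FrobeniusNonclassical.

(** * Transverse lines and tangent lines *)

Section Lines.

Variable K : closedFieldType.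
Implicit Types (f g h : {mpoly K[3]}) (P L v w u O : 'rV[K]_3).

Lemma parallelP (P Q : 'rV[K]_3) : (P <= Q)%MS <-> exists c, P = c *: Q.
Proof. by split=> [/sub_rVP|e] //; apply/sub_rVP. Qed.

Lemma linform_homog L : linform L \is 1.-homog.
Proof.
by apply: rpred_sum => i _; rewrite dhomogZ // dhomogX /= mdeg1.
Qed.

(** Otherwise the equation of the line would vanish on the curve, whose degree is
larger. *)
Lemma line_count (I : finType) (pts : I -> 'rV[K]_3) d f L :
  smooth f -> f \is d.+2.-homog -> f != 0 -> L != 0 ->
  (forall i, zero_locus f (pts i)) -> (forall i, dot L (pts i) = 0) ->
  (forall i j, i != j -> nonparallel (pts i) (pts j)) -> (#|I| <= d.+2)%N.
Proof.
move=> smf hf f0 L0 Cp Lp np; rewrite leqNgt; apply/negP => big.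
have /eqP := linform_neq0 L0; apply.
apply: (covers_low_degree smf hf (linform_homog L)) => //.
apply: (bezout_covers hf f0 (linform_homog L) Cp) => [i||] //.
  by rewrite peval_linform.
by rewrite muln1.
Qed.

Lemma dual_parallel L G (A B : 'rV[K]_3) : L != 0 -> A != 0 -> nonparallel B A ->
  dot L A = 0 -> dot L B = 0 -> dot G A = 0 -> dot G B = 0 -> exists c, G = c *: L.
Proof.
move=> L0 A0 np LA LB GA GB; have [u fr] := frame_exists A0 np.
have Lu : dot L u != 0.
  by apply: contraNneq L0 => Lu; apply/eqP; apply: frame_dot_eq0 fr _ _ _.
exists (dot G u / dot L u); apply/eqP; rewrite -subr_eq0; apply/eqP.
rewrite -scaleNr; apply: (frame_dot_eq0 fr); rewrite dotDl dotZl.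
- by rewrite mulNr divfK // subrr.
- by rewrite GB LB mulr0 addr0.
- by rewrite GA LA mulr0 addr0.
Qed.

Lemma multiple_root (r : seq K) : ~~ uniq r -> exists t,
  (\prod_(z <- r) ('X - z%:P)).[t] = 0 /\ (\prod_(z <- r) ('X - z%:P))^`().[t] = 0.
Proof.
elim: r => // x r IH; rewrite big_cons /= negb_and negbK.
have d t : (('X - x%:P) * \prod_(z <- r) ('X - z%:P))^`().[t] =
    (\prod_(z <- r) ('X - z%:P)).[t] + (t - x) * (\prod_(z <- r) ('X - z%:P))^`().[t].
  by rewrite derivM derivXsubC mul1r hornerD hornerM hornerXsubC.
case/orP=> [|/IH[t [p0 p'0]]]; last first.
  by exists t; rewrite d hornerM p0 p'0 !mulr0 addr0.
rewrite -root_prod_XsubC => /rootP p0; exists x.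
by rewrite d hornerM p0 subrr mul0r mulr0 addr0.
Qed.

Definition tangent_at f L P :=
  [/\ zero_locus f P, dot L P = 0 & exists c, gradient f P = c *: L].

Lemma line_basis L : exists A B : 'rV[K]_3,
  [/\ A != 0, nonparallel B A, dot L A = 0 & dot L B = 0].
Proof.
have [A A0 [LA _]] := line_through L 0; have [M MA] := dot_neq0 A0.
have [B B0 [LB MB]] := line_through L M.
exists A, B; split=> //; rewrite 1?dotC // => c eB.
move/eqP: MB; rewrite eB dotZl mulf_eq0 (negPf MA) orbF => /eqP c0.
by move: B0; rewrite eB c0 scale0r eqxx.
Qed.

(** Restrict f to L. If the restriction has full degree and simple roots, these are the
d.+1 points; a multiple root is a tangency point. If f vanishes on L, every point of L
is a tangency point. *)
Lemma transverse_or_tangent d f L : f \is d.+1.-homog -> L != 0 ->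
  transverse d.+1 f L \/ exists P, tangent_at f L P.
Proof.
move=> hf L0; have [A0 [B0 [nA0 npBA LA0 LB0]]] := line_basis L.
(* A multiple root t of f restricted to L is a tangency point: gradient f kills
   A there because of the multiplicity, and B by Euler, so it is parallel to L. *)
have tang (A B : 'rV[K]_3) t : A != 0 -> nonparallel B A -> dot L A = 0 -> dot L B = 0 ->
    (line f B A).[t] = 0 -> (line f B A)^`().[t] = 0 -> exists P, tangent_at f L P.
  move=> nA np LA LB; rewrite horner_line horner_deriv_line => fP gA.
  exists (B + t *: A); have P0 : B + t *: A != 0.
    apply/eqP => e; apply: (np (- t)); apply/eqP.
    by rewrite -subr_eq0 scaleNr opprK e.
  split; rewrite ?dotDr ?dotZr ?LA ?LB ?mulr0 ?addr0 //.
  have gB : dot (gradient f (B + t *: A)) B = 0.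
    have := euler (B + t *: A) hf.
    by rewrite fP mulr0 dotDr dotZr gA mulr0 addr0.
  exact: (dual_parallel L0 nA np).
have [[A [B [nA np LA LB fA]]]|l0] :
    (exists A B, [/\ A != 0, nonparallel B A, dot L A = 0, dot L B = 0 & peval f A != 0])
    \/ line f A0 B0 = 0.
- have [|/closed_nonrootP[t]] := eqVneq (line f A0 B0) 0; first by right.
  rewrite /root horner_line => fA; left; exists (A0 + t *: B0), B0; split=> //.
  + apply: contraNneq fA => ->; rewrite -(scale0r (0 : 'rV[K]_3)).
    by rewrite (peval_homog _ _ hf) expr0n mul0r.
  + move=> c e; have [c0|c0] := eqVneq c 0.
      by apply: (npBA 0); rewrite e c0 !scale0r.
    have : nonparallel A0 B0.
      move=> x eA; have x0 : x != 0 by apply: contraNneq nA0 => x0; rewrite eA x0 scale0r.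
      by apply: (npBA x^-1); rewrite eA scalerA mulVf // scale1r.
    move/(_ (c^-1 - t)); apply; apply: (scalerI c0).
    rewrite scalerA mulrBr divff // scalerBl scale1r {1}e scalerDr scalerA.
    by rewrite addrK.
  + by rewrite dotDr dotZr LA0 LB0 mulr0 addr0.
- have [sl cl] := line_homog B A hf.
  have sl' : size (line f B A) = d.+2.
    apply/eqP; rewrite eqn_leq sl ltnNge; apply: contraNN fA => h.
    by rewrite -cl nth_default.
  have l0 : line f B A != 0 by rewrite -size_poly_gt0 sl'.
  have lc : lead_coef (line f B A) = peval f A by rewrite lead_coefE sl' cl.
  set r := roots_of (line f B A).
  have lE : line f B A = peval f A *: \prod_(z <- r) ('X - z%:P).
    by rewrite {1}[line f B A]roots_ofE lc.
  have [ur|/multiple_root[t [p0 p'0]]] := boolP (uniq r); last first.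
    right; apply: (tang A B t) => //; rewrite lE ?derivZ hornerZ ?p0 ?p'0 mulr0 //.
  have sr : size r = d.+1.
    by have := sl'; rewrite lE size_scale // size_prod_XsubC => -[].
  left; exists (fun i : 'I_d.+1 => B + r`_i *: A); split.
  + move=> i; have : r`_i \in r by rewrite mem_nth // sr.
    rewrite -root_prod_XsubC => /rootP ri.
    split; last by apply/incidentE; rewrite dotDr dotZr LA LB mulr0 addr0.
    split; last by rewrite -horner_line lE hornerZ ri mulr0.
    apply/eqP => e; apply: (np (- r`_i)); apply/eqP.
    by rewrite -subr_eq0 scaleNr opprK e.
  + move=> i j /andP[/parallelP[c e] _].
    have : (1 - c) *: B = (c * r`_j - r`_i) *: A.
      move: (r`_i) (r`_j) e => x y /rowP e; apply/rowP=> k; move/eqP: (e k).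
      rewrite !mxE -subr_eq0 => /eqP h.
      by apply/eqP; rewrite -subr_eq0 -h; apply/eqP; ring.
    have [->|c1] := eqVneq c 1; last first.
      move=> e1; case: (np ((1 - c)^-1 * (c * r`_j - r`_i))).
      by rewrite -scalerA -e1 scalerA mulVf ?scale1r // subr_eq0 eq_sym.
    rewrite subrr scale0r mul1r => /esym/eqP; rewrite scaler_eq0 (negPf nA) orbF.
    rewrite subr_eq0 nth_uniq ?sr // => /eqP e1; exact/val_inj.
  + move=> P [[P0 fP] /incidentE LP].
    have [y [z eP]] := dot_span L0 np nA LA LB LP.
    have y0 : y != 0.
      apply: contraNneq P0 => y0; move/eqP: fP; rewrite eP y0 scale0r add0r.
      rewrite (peval_homog _ _ hf) mulf_eq0 (negPf fA) orbF expf_eq0 /= => /eqP ->.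
      by rewrite scale0r.
    have eP' : P = y *: (B + (z / y) *: A).
      by rewrite scalerDr scalerA [y * _]mulrC divfK.
    have zr : z / y \in r.
      rewrite -root_prod_XsubC; apply/rootP; apply/eqP.
      have := horner_line f B A (z / y); rewrite lE hornerZ.
      move: fP; rewrite eP' (peval_homog _ _ hf) => /eqP; rewrite mulf_eq0 expf_eq0 (negPf y0).
      by rewrite andbF => /eqP -> /eqP; rewrite mulf_eq0 (negPf fA).
    have lt : (index (z / y) r < d.+1)%N by rewrite -sr index_mem.
    exists (Ordinal lt) => /=; rewrite nth_index // eP'.
    apply/andP; split; apply/parallelP; first by exists y.
    by exists y^-1; rewrite scalerA mulVf // scale1r.
right; have nB0 : B0 != 0 by apply/eqP => B00; apply: (npBA 0); rewrite scale0r.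
apply: (tang B0 A0 0) => //; rewrite ?l0 ?deriv0 ?horner0 //.
move=> x eA; have x0 : x != 0 by apply: contraNneq nA0 => x0; rewrite eA x0 scale0r.
by apply: (npBA x^-1); rewrite eA scalerA mulVf // scale1r.
Qed.

End Lines.

(** * Points over the finite field *)

Section RationalPoints.

Variables (F : finFieldType) (K : closedFieldType) (iota : {rmorphism F -> K}).
Variables (p r : nat).
Hypothesis p_pr : prime p.
Hypothesis cardF : #|F| = (p ^ r)%N.
Let q := #|F|.

Lemma pcharK : p \in [pchar K].
Proof. by rewrite (fmorph_pchar iota); apply: card_finPcharP cardF p_pr. Qed.

Lemma frobD (x y : K) : (x + y) ^+ q = x ^+ q + y ^+ q.
Proof.
apply: exprDn_pchar; rewrite (eq_pnat _ (pcharf_eq pcharK)) /q cardF.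
by rewrite pnatX pnat_id.
Qed.

Lemma frob_iota c : iota c ^+ q = iota c.
Proof. by rewrite -rmorphXn /= expf_card. Qed.

Lemma frob_fixed (x : K) : x ^+ q = x -> exists c, x = iota c.
Proof.
move=> xq; have := congr1 (fun h => (map_poly iota h).[x]) (finField_genPoly F).
rewrite rmorphB rmorphXn /= !map_polyX hornerD hornerN hornerXn hornerX xq subrr.
rewrite rmorph_prod horner_prod => /esym/eqP; rewrite prodf_seq_eq0 => /hasP[c _].
rewrite /= rmorphB /= map_polyX map_polyC hornerXsubC subr_eq0 => /eqP ->.
by exists c.
Qed.

Lemma q_gt0 : (0 < q)%N.
Proof. by apply/card_gt0P; exists 0. Qed.

(** The coefficients of f are fixed by the q-th power map. *)
Lemma peval_frob (f : {mpoly F[3]}) P :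
  peval (map_mpoly iota f) (frob_point q P) = peval (map_mpoly iota f) P ^+ q.
Proof.
elim/mpolyind: f => [|c m f _ _ IH].
  by rewrite raddf0 !peval0 expr0n gtn_eqF ?q_gt0.
rewrite raddfD /= map_mpolyZ map_mpolyX !pevalD !pevalZ frobD exprMn frob_iota -IH.
congr (_ * _ + _); rewrite /peval !mevalX -prodrXl; apply: eq_bigr => i _.
by rewrite mxE exprAC.
Qed.

Lemma mderiv_map (f : {mpoly F[3]}) i :
  (map_mpoly iota f)^`M(i) = map_mpoly iota f^`M(i).
Proof.
by apply/mpolyP=> m; rewrite mcoeff_mderiv !mcoeff_map_mpoly mcoeff_mderiv raddfMn.
Qed.

Lemma gradient_frob (f : {mpoly F[3]}) P :
  gradient (map_mpoly iota f) (frob_point q P) = frob_point q (gradient (map_mpoly iota f) P).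
Proof. by apply/rowP=> i; rewrite !mxE mderiv_map peval_frob. Qed.

Lemma map_mpoly_homog d (f : {mpoly F[3]}) :
  f \is d.-homog -> map_mpoly iota f \is d.-homog.
Proof.
move=> /dhomogP hf; apply/dhomogP => m; rewrite mcoeff_msupp mcoeff_map_mpoly.
by rewrite fmorph_eq0 -mcoeff_msupp => /hf.
Qed.

Lemma map_mpoly_neq0 (f : {mpoly F[3]}) : f != 0 -> map_mpoly iota f != 0.
Proof.
apply: contraNneq => e; apply/eqP/mpolyP=> m; apply: (fmorph_inj iota).
by rewrite -mcoeff_map_mpoly e !mcoeff0 rmorph0.
Qed.

Definition vec3 (a b c : F) : 'rV[F]_3 :=
  \row_i (if i == 0 :> nat then a else if i == 1%N :> nat then b else c).

(** The points of the projective plane over F, by the position of the first nonzero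
coordinate, which is normalized to 1 in [coords]: (1 : a : b), (0 : 1 : a), (0 : 0 : 1). *)
Definition ppoint := ((F * F + F) + unit)%type.

Definition coords (t : ppoint) : 'rV[F]_3 :=
  match t with
  | inl (inl ab) => vec3 1 ab.1 ab.2
  | inl (inr a) => vec3 0 1 a
  | inr _ => vec3 0 0 1
  end.

Definition geom_coords t : 'rV[K]_3 := map_mx iota (coords t).

Lemma card_ppoint : #|{: ppoint}| = (q * q + q + 1)%N.
Proof. by rewrite !card_sum card_prod card_unit. Qed.

Let i0 : 'I_3 := inord 0.
Let i1 : 'I_3 := inord 1.
Let i2 : 'I_3 := inord 2.

Lemma ord3_cases (i : 'I_3) : [\/ i = i0, i = i1 | i = i2].
Proof.
case: i => [[|[|[|//]]] lti]; [apply: Or31|apply: Or32|apply: Or33];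
  by apply: val_inj; rewrite /= inordK.
Qed.

Lemma row3P (T : Type) (u v : 'rV[T]_3) :
  u 0 i0 = v 0 i0 -> u 0 i1 = v 0 i1 -> u 0 i2 = v 0 i2 -> u = v.
Proof. by move=> *; apply/rowP=> i; case: (ord3_cases i) => ->. Qed.

Lemma vec3E a b c : [/\ vec3 a b c 0 i0 = a, vec3 a b c 0 i1 = b & vec3 a b c 0 i2 = c].
Proof. by rewrite !mxE !inordK. Qed.

Lemma vec3_0 a b c : vec3 a b c 0 i0 = a. Proof. by case: (vec3E a b c). Qed.
Lemma vec3_1 a b c : vec3 a b c 0 i1 = b. Proof. by case: (vec3E a b c). Qed.
Lemma vec3_2 a b c : vec3 a b c 0 i2 = c. Proof. by case: (vec3E a b c). Qed.
Definition vec3_coef := (vec3_0, vec3_1, vec3_2).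

Lemma coords_neq0 t : coords t != 0.
Proof.
apply/eqP=> e; case: t e => [[[a b]|a]|u] /rowP e.
- by have := e i0; have [-> _ _] := vec3E 1 a b; rewrite mxE => /eqP; rewrite oner_eq0.
- by have := e i1; have [_ -> _] := vec3E 0 1 a; rewrite mxE => /eqP; rewrite oner_eq0.
- by have := e i2; have [_ _ ->] := vec3E 0 0 1; rewrite mxE => /eqP; rewrite oner_eq0.
Qed.

Lemma geom_coords_neq0 t : geom_coords t != 0.
Proof. by rewrite map_mx_eq0 coords_neq0. Qed.

Lemma coords_surj Q : Q != 0 -> exists t, exists2 k, k != 0 & Q = k *: coords t.
Proof.
move=> Q0; have [Q00|n0] := eqVneq (Q 0 i0) 0; last first.
  exists (inl (inl (Q 0 i1 / Q 0 i0, Q 0 i2 / Q 0 i0))), (Q 0 i0) => //.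
  have [e0 e1 e2] := vec3E 1 (Q 0 i1 / Q 0 i0) (Q 0 i2 / Q 0 i0).
  by apply: row3P; rewrite [RHS]mxE ?e0 ?e1 ?e2 ?mulr1 // mulrC divfK.
have [Q10|n1] := eqVneq (Q 0 i1) 0; last first.
  exists (inl (inr (Q 0 i2 / Q 0 i1))), (Q 0 i1) => //.
  have [e0 e1 e2] := vec3E 0 1 (Q 0 i2 / Q 0 i1).
  by apply: row3P; rewrite [RHS]mxE ?e0 ?e1 ?e2 ?mulr1 ?mulr0 // mulrC divfK.
have n2 : Q 0 i2 != 0.
  apply: contraNneq Q0 => Q20; apply/eqP; apply: row3P; by rewrite ?Q00 ?Q10 ?Q20 mxE.
exists (inr tt), (Q 0 i2) => //; have [e0 e1 e2] := vec3E 0 0 1.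
by apply: row3P; rewrite [RHS]mxE ?e0 ?e1 ?e2 ?mulr1 ?mulr0.
Qed.

Lemma coords_inj s t c : coords s = c *: coords t -> s = t.
Proof.
move=> /rowP e; move: (e i0) (e i1) (e i2); rewrite [X in _ = X -> _]mxE.
rewrite [X in _ -> _ = X -> _]mxE [X in _ -> _ -> _ = X -> _]mxE.
case: s {e} => [[[a b]|a]|[]]; case: t => [[[a' b']|a']|[]] /=;
  rewrite !vec3_coef ?mulr1 ?mulr0.
- by move=> <-; rewrite !mul1r => -> ->.
- by move=> /eqP; rewrite oner_eq0.
- by move=> /eqP; rewrite oner_eq0.
- by move=> <-; rewrite mul0r => /eqP; rewrite oner_eq0.
- by move=> _ <-; rewrite mul1r => ->.
- by move=> _ /eqP; rewrite oner_eq0.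
- by move=> <-; rewrite !mul0r => _ /eqP; rewrite oner_eq0.
- by move=> _ <-; rewrite mul0r => /eqP; rewrite oner_eq0.
- by [].
Qed.

Lemma geom_coords_inj s t c : geom_coords s = c *: geom_coords t -> s = t.
Proof.
move=> e; have [i ti] := rV_neq0 (coords_neq0 t).
have ec : c = iota (coords s 0 i / coords t 0 i).
  by move/rowP/(_ i): e; rewrite !mxE fmorph_div => ->; rewrite mulfK // fmorph_eq0.
apply: (@coords_inj _ _ (coords s 0 i / coords t 0 i)); apply/rowP=> j.
apply: (fmorph_inj iota); move/rowP/(_ j): e; rewrite !mxE ec => ->.
by rewrite [RHS]rmorphM.
Qed.

Lemma frob_geom_coords t : frob_point q (geom_coords t) = geom_coords t.
Proof. by apply/rowP=> i; rewrite !mxE frob_iota. Qed.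

(** Dividing by a nonzero coordinate makes all the coordinates fixed points of the
q-th power map. *)
Lemma rational_of_parallel P c : P != 0 -> frob_point q P = c *: P ->
  exists t, exists2 k, k != 0 & P = k *: geom_coords t.
Proof.
move=> P0 /rowP eP; have [i Pi] := rV_neq0 P0.
have ePj j : P 0 j ^+ q = c * P 0 j by have := eP j; rewrite !mxE.
have c0 : c != 0.
  apply: contraNneq Pi => c0; have := ePj i; rewrite c0 mul0r => /eqP.
  by rewrite expf_eq0 => /andP[_].
have rational_tangency j : exists y, P 0 j / P 0 i = iota y.
  apply: frob_fixed; rewrite expr_div_n !ePj; field; by rewrite Pi c0.
have [y ey] := fin_all_exists rational_tangency.
have eQ : P = P 0 i *: map_mx iota (\row_j y j).
  by apply/rowP=> j; rewrite !mxE -ey mulrC divfK.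
have Q0 : \row_j y j != 0.
  by apply: contraNneq P0 => e; rewrite eQ e raddf0 scaler0.
have [t [k k0 et]] := coords_surj Q0; exists t, (P 0 i * iota k).
  by rewrite mulf_neq0 // fmorph_eq0.
by rewrite {1}eQ et map_mxZ scalerA.
Qed.

End RationalPoints.

Lemma dot3 (K : fieldType) (L v : 'rV[K]_3) :
  dot L v = L 0 (inord 0) * v 0 (inord 0) + L 0 (inord 1) * v 0 (inord 1)
          + L 0 (inord 2) * v 0 (inord 2).
Proof.
rewrite /dot !big_ord_recl big_ord0 addr0 addrA.
have -> : ord0 = inord 0 :> 'I_3 by apply: val_inj; rewrite /= inordK.
have -> : lift (inord 0) ord0 = inord 1 :> 'I_3 by apply: val_inj; rewrite /= !inordK.
by have -> : lift (inord 0) (lift ord0 ord0) = inord 2 :> 'I_3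
  by apply: val_inj; rewrite /= !inordK.
Qed.

(** * Quadratic syzygies of p-th powers *)

Section Syzygy.

Variable K : closedFieldType.

Lemma peval_homog0 (h : {mpoly K[3]}) P : h \is 0.-homog -> peval h P = peval h 0.
Proof. by move=> hh; rewrite -(scale0r P) (peval_homog _ _ hh) mul1r. Qed.

Lemma dirder_frob_sum p (g : 'I_3 -> {mpoly K[3]}) v : p%:R = 0 :> K ->
  dirder v (\sum_i 'X_i ^+ p * g i) = \sum_i 'X_i ^+ p * dirder v (g i).
Proof.
move=> p0; rewrite (big_morph _ (dirder_addr v) (dirder0 v)).
apply: eq_bigr => i _; rewrite /dirder [RHS]mulr_sumr; apply: eq_bigr => j _.
by rewrite mderivM mderiv_expn p0 scale0r mul0r add0r scalerAr.
Qed.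

(** The derivations of K[x] see x_i^p as a constant, so applying two of them leaves the
relation sum x_i^p c_i = 0 between constants c_i, which are zero by evaluation at the
coordinate points. Euler's identity, for degree 1 and then for degree 2, brings this
back to g_i. *)
Lemma quadratic_syzygy p (g : 'I_3 -> {mpoly K[3]}) :
  p \in [pchar K] -> (2 : K) != 0 -> (forall i, g i \is 2.-homog) ->
  \sum_i 'X_i ^+ p * g i = 0 -> forall i, g i = 0.
Proof.
move=> pK two hg E0 i; have p0 := pcharf0 pK.
have h0 v w P : peval (hessian (g i) v w) P = 0.
  have := congr1 (dirder v) (congr1 (dirder w) E0).
  rewrite !dirder_frob_sum // !dirder0.
  move=> /(congr1 (fun h : {mpoly K[3]} => peval h (delta_mx 0 i))).
  rewrite peval0 peval_sum (bigD1 i) //= big1 ?addr0 => [|j ji].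
    rewrite pevalM pevalXn pevalX mxE !eqxx expr1n mul1r => e.
    by rewrite -e (peval_homog0 _ (hessian_homog v w (hg i))) -(peval_homog0 (delta_mx 0 i)) //
      hessian_homog.
  rewrite pevalM pevalXn pevalX mxE (negPf ji) andbF expr0n.
  by rewrite gtn_eqF ?mul0r // prime_gt0 // (pcharf_prime pK).
have d0 w P : peval (dirder w (g i)) P = 0.
  have := euler P (dirder_homog w (hg i)).
  by rewrite -peval_dirder -/(hessian _ P w) h0 mul1r => <-.
apply: peval_ext => P; rewrite peval0; apply: (mulfI two).
by rewrite mulr0 -(euler P (hg i)) -peval_dirder d0.
Qed.

End Syzygy.

(** * Counting tangency points *)

Section Tangents.

Variables (F : finFieldType) (K : closedFieldType) (iota : {rmorphism F -> K}).
Variables (p r : nat).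
Hypothesis p_pr : prime p.
Hypothesis cardF : #|F| = (p ^ r)%N.
Let q := #|F|.

Variables (d : nat) (f : {mpoly F[3]}).
Hypothesis hf : f \is d.+2.-homog.
Hypothesis f0 : f != 0.
Let fK := map_mpoly iota f.
Hypothesis smf : smooth fK.

Local Notation geom_coords := (geom_coords iota).

Let hfK : fK \is d.+2.-homog := map_mpoly_homog iota hf.
Let fK0 : fK != 0 := map_mpoly_neq0 iota f0.

Lemma gradient_scale c P : gradient fK (c *: P) = c ^+ d.+1 *: gradient fK P.
Proof. by apply/rowP=> i; rewrite !mxE (peval_homog _ _ (mderiv_homog i hfK)). Qed.

(** The line is the class of the gradient at the tangency point. *)
Lemma tangent_inj s t P Q k : tangent_at fK (geom_coords s) P ->
  tangent_at fK (geom_coords t) Q -> P = k *: Q -> s = t.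
Proof.
move=> [CP _ [c gP]] [CQ _ [c' gQ]] eP.
have c0 : c != 0 by apply: contraNneq (smf CP) => c0; rewrite gP c0 scale0r.
apply: (@geom_coords_inj _ _ iota _ _ (c^-1 * (k ^+ d.+1 * c'))).
by rewrite -scalerA -scalerA -gQ -gradient_scale -eP gP scalerA mulVf // scale1r.
Qed.

Lemma dot_frob_point (L P : 'rV[K]_3) : dot (frob_point q L) (frob_point q P) = dot L P ^+ q.
Proof. by rewrite !dot3 !mxE !(frobD iota p_pr cardF) !exprMn. Qed.

Lemma tangent_frob_point t P : tangent_at fK (geom_coords t) P ->
  tangent_at fK (geom_coords t) (frob_point q P).
Proof.
move=> [[P0 fP] LP [c gP]]; have q0 := q_gt0 F; split.
- split; last by rewrite (peval_frob iota p_pr cardF) fP expr0n gtn_eqF.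
  have [i Pi] := rV_neq0 P0; apply: contraNneq Pi => /rowP/(_ i).
  by rewrite !mxE => /eqP; rewrite expf_eq0 => /andP[].
- by rewrite -(frob_geom_coords iota t) dot_frob_point LP expr0n gtn_eqF.
exists (c ^+ q); rewrite (gradient_frob iota p_pr cardF) gP.
apply/rowP=> i; rewrite !mxE exprMn frob_iota //.
Qed.

(** The q + 1 lines through (0 : 0 : 1) cover the rational points; [None] is the line
x_0 = 0, which contains (0 : 0 : 1) and the points (0 : 1 : a). *)
Definition parallel_class (s : ppoint F) : option F :=
  if s is inl (inl ab) then Some ab.1 else None.

Definition class_line (c : option F) : 'rV[F]_3 :=
  if c is Some a then vec3 a (-1) 0 else vec3 1 0 0.

Lemma class_lineP s : dot (map_mx iota (class_line (parallel_class s))) (geom_coords s) = 0.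
Proof.
rewrite dot3 ![map_mx _ _ _ _]mxE -!rmorphM -!rmorphD; apply/eqP.
rewrite fmorph_eq0; case: s => [[[a b]|a]|u] /=; rewrite !vec3_coef; apply/eqP; ring.
Qed.

Lemma class_line_neq0 c : map_mx iota (class_line c) != 0.
Proof.
rewrite map_mx_eq0; case: c => [a|]; apply/eqP => /rowP e.
  by have := e (inord 1); rewrite vec3_coef mxE => /eqP; rewrite oppr_eq0 oner_eq0.
by have := e (inord 0); rewrite vec3_coef mxE => /eqP; rewrite oner_eq0.
Qed.

Lemma rational_zero_count :
  (#|[set s : ppoint F | peval fK (geom_coords s) == 0%R]| <= d.+2 * q.+1)%N.
Proof.
set Z := [set s | _]; rewrite -sum1_card (partition_big parallel_class predT) //=.
have -> : (d.+2 * q.+1 = \sum_(c : option F) d.+2)%N.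
  by rewrite sum_nat_const card_option mulnC.
apply: leq_sum => c _; rewrite sum1dep_card cardE.
pose I := {s : ppoint F | (s \in Z) && (parallel_class s == c)}.
have cI : #|{: I}| = #|[set x in Z | parallel_class x == c]|.
  by rewrite card_sig; apply: eq_card => x; rewrite !inE.
rewrite -cardE -cI; apply: (@line_count K I (fun i => geom_coords (val i)) d fK
    (map_mx iota (class_line c)) smf hfK fK0 (class_line_neq0 c)).
- move=> i; have /andP[] := valP i; rewrite inE => /eqP fs _; split=> //.
  exact: geom_coords_neq0.
- move=> i; have /andP[_ /eqP ec] := valP i.
  by have := class_lineP (val i); rewrite ec.
move=> i j ij x e; case/eqP: ij; apply: val_inj; exact: (geom_coords_inj e).
Qed.

Variable tp : ppoint F -> 'rV[K]_3.
Hypothesis tpP : forall t, tangent_at fK (geom_coords t) (tp t).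

Definition rational_tangency t := [exists s, (tp t <= geom_coords s)%MS].

Lemma rational_tangency_count : (#|[set t | rational_tangency t]| <= d.+2 * q.+1)%N.
Proof.
pose sg t := odflt t [pick s | (tp t <= geom_coords s)%MS].
have sgP t : rational_tangency t -> exists2 k, k != 0 & tp t = k *: geom_coords (sg t).
  move=> /existsP[s ts]; rewrite /sg; case: pickP => [s'|/(_ s)]; last by rewrite ts.
  move=> /parallelP[k e] /=; exists k => //.
  have [[t0 _] _ _] := tpP t; apply: contraNneq t0 => k0.
  by rewrite e k0 scale0r.
have sg_inj : {in [set t | rational_tangency t] &, injective sg}.
  move=> s t; rewrite !inE => /sgP[k k0 es] /sgP[k' k'0 et] e.
  apply: (tangent_inj (tpP s) (tpP t) (k := k / k')).
  by rewrite et scalerA divfK // es e.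
rewrite -(card_in_imset sg_inj); apply: leq_trans rational_zero_count.
apply: subset_leq_card; apply/subsetP=> y /imsetP[t]; rewrite inE => /sgP[k k0 et] ->.
have [[_ ft] _ _] := tpP t; rewrite inE.
by move/eqP: ft; rewrite et (peval_homog _ _ hfK) mulf_eq0 expf_eq0 (negPf k0) andbF.
Qed.

Lemma nonrational_nonparallel t : ~~ rational_tangency t ->
  nonparallel (frob_point q (tp t)) (tp t).
Proof.
move=> nt c e; have [[t0 _] _ _] := tpP t.
have [s [k k0 ek]] := rational_of_parallel iota t0 e.
by case/negP: nt; apply/existsP; exists s; apply/parallelP; exists k.
Qed.

(** The common points of the curve and of [tangent_frob] that are counted here are all
the tangency points, together with the conjugates of the nonrational ones. *)
Lemma tangent_frob_covers :
  (d.+2 * (q + d.+1) + d.+2 * q.+1 < 2 * (q * q + q + 1))%N ->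
  covers fK (tangent_frob q fK).
Proof.
move=> big; pose I := (ppoint F + {t | ~~ rational_tangency t})%type.
pose pts (i : I) := match i with inl t => tp t | inr t => frob_point q (tp (val t)) end.
have Dtan t P : tangent_at fK (geom_coords t) P -> dot (gradient fK P) (frob_point q P) = 0.
  move=> tP; have [_ _ [c gP]] := tP; have [_ LP _] := tangent_frob_point tP.
  by rewrite gP dotZl LP mulr0.
pose line_of (i : I) := match i with inl t => t | inr t => val t end.
have ptsT i : tangent_at fK (geom_coords (line_of i)) (pts i).
  by case: i => [t|[t nt]] /=; [exact: tpP | apply: tangent_frob_point; exact: tpP].
apply: (@bezout_covers K I pts d.+1 (q + d.+1) fK (tangent_frob q fK) hfK fK0).
- exact: tangent_frob_homog.
- by move=> i; have [] := ptsT i.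
- by move=> i; rewrite peval_tangent_frob; apply: Dtan (ptsT i).
- move=> i j ij c e; have := tangent_inj (ptsT i) (ptsT j) e.
  case: i j ij e => [s|[s ns]] [t|[t nt]] /= ij e est.
  + by case/eqP: ij; rewrite est.
  + case: (nonrational_nonparallel nt (c := c^-1)); rewrite -{2}est e scalerA mulVf ?scale1r //.
    have [[s0 _] _ _] := tpP s; apply: contraNneq s0 => c0.
    by rewrite e c0 scale0r.
  + by apply: (nonrational_nonparallel ns (c := c)); rewrite e est.
  + by case/eqP: ij; congr inr; apply: val_inj.
have cardR : (#|[set t | rational_tangency t]| +
    #|[pred t | ~~ rational_tangency t]| = q * q + q + 1)%N.
  rewrite -(card_ppoint F) -(cardC [set t | rational_tangency t]); congr addn.
  by apply: eq_card => t; rewrite !inE.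
have := rational_tangency_count; rewrite card_sum card_sig card_ppoint.
move: cardR big; rewrite -/q; move: #|_| #|_| => a b; lia.
Qed.

Lemma all_tangent_hessian_eq0 : (2 : K) != 0 -> d.+1%:R = 0 :> K -> (0 < r)%N ->
  (d.+2 * (q + d.+1) + d.+2 * q.+1 < 2 * (q * q + q + 1))%N ->
  forall v w, hessian fK v w = 0.
Proof.
move=> two d0 r0 big; have cov := tangent_frob_covers big.
have pK := pcharK iota p_pr cardF.
have q0 : q%:R = 0 :> K.
  by rewrite /q cardF natrX (pcharf0 pK) expr0n gtn_eqF.
apply: (hessian_eq0 (bad := [seq geom_coords t | t <- enum {: ppoint F}]) smf hfK fK0 two).
move=> P CP nbad; apply: (frobenius_flex smf hfK d0 q0 cov CP) => c e.
have [P0 _] := CP; have [t [k k0 eP]] := rational_of_parallel iota P0 e.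
by apply: (nbad (geom_coords t) _ k eP); apply: map_f; rewrite mem_enum.
Qed.

End Tangents.

(** * The theorem *)

(** The q + 1 lines over F through the i-th coordinate point. *)
Lemma coordinate_pencil (F : finFieldType) (i : 'I_3) :
  exists2 s : option F -> ppoint F, injective s & forall c, coords (s c) 0 i = 0.
Proof.
case: (ord3_cases i) => ->.
- exists (fun c => if c is Some a then inl (inr a) else inr tt).
    by move=> [a|] [b|] //= [->].
  by move=> [a|]; rewrite /= vec3_coef.
- exists (fun c => if c is Some a then inl (inl (0, a)) else inr tt).
    by move=> [a|] [b|] //= [->].
  by move=> [a|]; rewrite /= vec3_coef.
- exists (fun c => if c is Some a then inl (inl (a, 0)) else inl (inr 0)).
    by move=> [a|] [b|] //= [->].
  by move=> [a|]; rewrite /= vec3_coef.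
Qed.

(** With d = p k + 1, the left side is d (q + d - 1) + d (q + 1). The difference of the
two sides is smallest for k = 2, p = 3 and q = 9, where it is still positive (175 < 182); the
explicit remainder in the proof is its expansion around that point. *)
Lemma tangency_bound p k q : (2 < p)%N -> (k <= 2)%N -> (p * p <= q)%N ->
  ((p * k).+1 * (q + p * k) + (p * k).+1 * q.+1 < 2 * (q * q + q + 1))%N.
Proof.
move=> p2 k2 pq; have pk : (p * k <= 2 * p)%N by rewrite mulnC leq_mul2r k2 orbT.
apply: (@leq_ltn_trans ((2 * p).+1 * (q + 2 * p) + (2 * p).+1 * q.+1)).
  by rewrite leq_add ?leq_mul ?ltnS ?leq_add2l.
have [s ps] : exists s, p = (s + 3)%N by exists (p - 3)%N; rewrite subnK.
have [e ->] : exists e, q = (e + p * p)%N by exists (q - p * p)%N; rewrite subnK.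
suff -> : (2 * ((e + p * p) * (e + p * p) + (e + p * p) + 1) =
      (2 * p).+1 * (e + p * p + 2 * p) + (2 * p).+1 * (e + p * p).+1
    + (2 * e * e + 4 * e * p * (s + 2)
       + 2 * p * (1 + 13 * s + 7 * s * s + s * s * s)).+1)%N.
  by rewrite addnS ltnS leq_addr.
by rewrite ps; lia.
Qed.

Section AllTangent.

Variables (p r k d : nat) (F : finFieldType).
Variables (K : closedFieldType) (iota : {rmorphism F -> K}) (f : {mpoly F[3]}).
Hypotheses (p_pr : prime p) (p_gt2 : (2 < p)%N) (r_ge2 : (2 <= r)%N).
Hypothesis cardF : #|F| = (p ^ r)%N.
Hypotheses (k_gt0 : (0 < k)%N) (k_le2 : (k <= 2)%N) (dE : d.+1 = (p * k)%N).
Hypotheses (f0 : f != 0) (hf : f \is d.+2.-homog).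
Let fK := map_mpoly iota f.
Hypothesis smf : smooth fK.

Lemma not_all_tangent : ~ (forall t, exists P, tangent_at fK (geom_coords iota t) P).
Proof.
move=> /fin_all_exists[tp tpP]; set q := #|F|.
have p_gt0 := prime_gt0 p_pr; have pK := pcharK iota p_pr cardF.
have two : (2 : K) != 0.
  by rewrite -(dvdn_pcharf pK) gtnNdvd.
have d10 : d.+1%:R = 0 :> K by rewrite dE natrM (pcharf0 pK) mul0r.
have hfK : fK \is d.+2.-homog := map_mpoly_homog iota hf.
have fK0 : fK != 0 := map_mpoly_neq0 iota f0.
have pq : (p * p <= q)%N.
  by rewrite /q cardF mulnn leq_pexp2l.
have big : (d.+2 * (q + d.+1) + d.+2 * q.+1 < 2 * (q * q + q + 1))%N.
  by rewrite dE; apply: tangency_bound.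
have H0 := all_tangent_hessian_eq0 p_pr cardF hf f0 smf tpP two d10 (ltnW r_ge2) big.
have root_i i : exists g, g \is k.-homog /\ fK^`M(i) = g ^+ p.
  have [||g hg eg] := @pth_root_form K p k (fK^`M(i)) pK; last by exists g.
    by rewrite -dE; apply: mderiv_homog.
  by move=> j; have := H0 (delta_mx 0 j) (delta_mx 0 i); rewrite /hessian !dirder_delta.
have [g g_] := fin_all_exists root_i.
have hg i : g i \is k.-homog by have [] := g_ i.
have eg i : fK^`M(i) = g i ^+ p by have [] := g_ i.
have [i gi0] : exists i, g i != 0.
  apply/existsP; apply: contraT; rewrite negb_exists => /forallP g0.
  case/eqP: fK0; apply: peval_ext => P; rewrite peval0.
  have := euler P hfK; rewrite -addn1 natrD d10 add0r mul1r => <-.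
  rewrite /dot big1 // => i _; rewrite mxE eg.
  by have := g0 i; rewrite negbK => /eqP ->; rewrite expr0n gtn_eqF // peval0 mul0r.
(* If few zeros of g i are allowed, use the lines through the i-th coordinate point. *)
have [lt_kq|ge_kq] := ltnP (d.+2 * k) q.+1.
- have [s s_inj s0] := coordinate_pencil F i.
  case/eqP: gi0; apply: (covers_low_degree smf hfK (hg i)).
    by rewrite dE ltnS leq_pmull.
  apply: (@bezout_covers K (option F) (fun c => tp (s c)) d.+1 k fK) => //.
  + by move=> c; have [] := tpP (s c).
  + move=> c; have [_ _ [x gP]] := tpP (s c).
    have : peval (fK^`M(i)) (tp (s c)) = 0.
      by move/rowP/(_ i): gP; rewrite !mxE s0 rmorph0 mulr0.
    by rewrite eg pevalXn => /eqP; rewrite expf_eq0 p_gt0 => /eqP.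
  + move=> c c' cc x e; case/eqP: cc; apply: s_inj.
    exact: (tangent_inj hf smf (tpP _) (tpP _) e).
  by rewrite card_option.
(* Since q >= p^2, what remains is k = 2 and q = p^2. *)
have k2 : k = 2%N.
  apply/eqP; rewrite eqn_leq k_le2 ltnNge; apply/negP => k1.
  have ek : k = 1%N by apply/eqP; rewrite eqn_leq k1.
  by move: ge_kq pq p_gt2; rewrite dE ek; generalize q; clear; nia.
have r2 : r = 2%N.
  apply/eqP; rewrite eqn_leq r_ge2 andbT leqNgt; apply/negP => r3.
  have : (p * p * p <= q)%N by rewrite -mulnA mulnn -expnS /q cardF leq_pexp2l.
  by move: ge_kq p_gt2; rewrite dE k2; generalize q; clear; nia.
have hg2 j : g j \is 2.-homog by have := hg j; rewrite k2.
pose E := \sum_i 'X_i ^+ p * g i.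
have pm := pchar_mpoly pK.
have EE : tangent_frob q fK = E ^+ p.
  rewrite -(pFrobenius_autE pm) raddf_sum; apply: eq_bigr => j _ /=.
  by rewrite pFrobenius_autE exprMn -exprM -eg /q cardF r2 mulnn.
have hE : E \is (p + 2).-homog.
  apply: rpred_sum => j _; apply: dhomogM (hg2 j).
  by rewrite -[p in p.-homog]mul1n; apply: dhomogMn; rewrite dhomogX /= mdeg1.
have covE : covers fK E.
  have [O [fO com]] := tangent_frob_covers p_pr cardF hf f0 smf tpP big.
  exists O; split=> // w /com[z [fz]]; rewrite -/q EE pevalXn => Ez.
  by exists z; split=> //; apply/eqP; move/eqP: Ez; rewrite expf_eq0 p_gt0.
case/eqP: gi0; apply: (quadratic_syzygy pK two hg2).
apply: (covers_low_degree smf hfK hE) covE.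
by rewrite dE k2; move: p_gt2; clear; lia.
Qed.

End AllTangent.

Theorem theorem1p4 (p r d : nat) (F : finFieldType)
    (* K is an algebraic closure of F *)
    (K : closedFieldType) (iota : {rmorphism F -> K})
    (f : {mpoly F[3]}) :
  prime p -> (2 < p)%N -> (2 <= r)%N -> #|F| = (p ^ r)%N ->
  (forall x : K, algebraicOver iota x) ->
  d = (p + 1)%N \/ d = (2 * p + 1)%N ->
  f != 0 -> f \is d.-homog ->
  smooth (map_mpoly iota f) ->
  ~ reflexive_curve (zero_locus (map_mpoly iota f)) ->
  exists2 L : 'rV[F]_3, L != 0 &
    transverse d (map_mpoly iota f) (map_mx iota L).
Proof.
move=> p_pr p_gt2 r_ge2 cardF _ d_eq f0 hf smf _.
have [k [d0 [k_gt0 k_le2 d0E dE]]] :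
    exists k d0, [/\ (0 < k)%N, (k <= 2)%N, d0.+1 = (p * k)%N & d = d0.+2].
  by case: d_eq => ->; [exists 1, p.-1 | exists 2, (2 * p).-1]; split; lia.
rewrite {d d_eq}dE in hf *.
have hfK := map_mpoly_homog iota hf.
have dich t : exists b : bool, if b then transverse d0.+2 (map_mpoly iota f) (geom_coords iota t)
    else exists P, tangent_at (map_mpoly iota f) (geom_coords iota t) P.
  have [tr|tg] := transverse_or_tangent hfK (geom_coords_neq0 iota t).
    by exists true.
  by exists false.
have [b b_] := fin_all_exists dich.
have [/existsP[t bt]|] := boolP [exists t, b t].
  by exists (coords t); [exact: coords_neq0 | have := b_ t; rewrite bt].
rewrite negb_exists => /forallP nb.
case: (not_all_tangent p_pr p_gt2 r_ge2 cardF k_gt0 k_le2 d0E f0 hf smf) => t.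
by have := b_ t; rewrite (negPf (nb t)).
Qed.
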